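(* Let $\Pi_n$ be Gnedin's partition of $[n]$ with parameters $(\gamma,\zeta)$, where $\gamma\ge0$ and $j^2-\gamma j+\zeta>0$ for all integers $j\ge1$, and let $|A_{(1)}|$ be its largest block size. Let $z_1,z_2,s_1,s_2$ be such that $z_1z_2=s_1s_2=\zeta$ and $z_1+z_2=-(s_1+s_2)=\gamma$. Then $$\mathbb{P}(|A_{(1)}|\le r)\sim B(z_1,z_2)\sum_{m=\lceil x^{-1}\rceil}^\infty\frac{(s_1)_m(s_2)_m}{m!(m-1)!}\rho_{-1,m}(x),\qquad n,r\to\infty,\ r\sim xn,$$ where $$\rho_{-1,m}(x)=\sum_{k=0}^{\lfloor x^{-1}\rfloor}(-1)^k\binom{m}{k}\mathcal{I}^{(k)}_{x,0}(1;m-k)\quad\text{if }\lceil x^{-1}\rceil\le m,\qquad \rho_{-1,m}(x)=0\quad\text{if }\lceil x^{-1}\rceil>m.$$ Moreover, $$\mathbb{E}\left(\frac{[|A_{(1)}|]_j}{n^j}\right)\sim1-B(z_1,z_2)\,j\sum_{m=2}^\infty\frac{(s_1)_m(s_2)_m}{m!(m-1)!}\mu^{(j-1)}_{-1,m},\qquad n\to\infty,\quad j=1,2,\dots,$$ where $\mu^{(j)}_{-1,m}=\int_0^1x^j\rho_{-1,m}(x)\,dx$ are the $j$-th moments of $\rho_{-1,m}(x)$.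
   Context: Notation: $(x)_i=x(x+1)\cdots(x+i-1)$, $(x)_0=1$; $[x]_i=x(x-1)\cdots(x-i+1)$, $[x]_0=1$; $B(z_1,z_2)=\Gamma(z_1)\Gamma(z_2)/\Gamma(z_1+z_2)$ is the Beta function. Gnedin's partition with parameters $(\gamma,\zeta)$, where $\gamma\ge0$ and $j^2-\gamma j+\zeta>0$ for all integers $j\ge1$, is the exchangeable random partition $\Pi_n$ of $[n]=\{1,\dots,n\}$ in which each partition of $[n]$ with blocks of sizes $n_1,\dots,n_k$ has probability $v_{n,k}\prod_{j=1}^k(2)_{n_j-1}=v_{n,k}\prod_{j=1}^k n_j!$, with $$v_{n,k}=(\gamma)_{n-k}\frac{\prod_{j=1}^{k-1}(j^2-\gamma j+\zeta)}{\prod_{j=1}^{n-1}(j^2+\gamma j+\zeta)}.$$ $|A_{(1)}|$ denotes the largest block size. Incomplete Dirichlet integrals: for nonzero real $\nu,\rho$ and integer $b\ge1$, $$\mathcal{I}_{p,q}^{(b)}(\nu;\rho)=\frac{\Gamma(\rho+b\nu)}{\Gamma(\rho)\Gamma(\nu)^b}\int_{\Delta_b(p,q)}y_{b+1}^{\rho-1}\prod_{j=1}^b y_j^{\nu-1}\,dy_j,\qquad y_{b+1}=1-\sum_{j=1}^b y_j,$$ with $\Delta_b(p,q)=\{(y_1,\dots,y_b):y_i>p\ (1\le i\le b),\ \sum_{j=1}^b y_j<1-q\}$, and $\mathcal{I}^{(0)}_{p,q}(\nu;\rho)=1$; if $\Delta_b(p,q)$ is empty, the integral is $0$.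
   Formalization: The cases γ=0 and ζ=0 are excluded, since there B(z_1,z_2) involves Γ(0) and is undefined; x ranges over all positive reals except x=1, where the claim fails for r=n−1 because a single block has positive limiting probability. *)

(* Defs.v *)
From HB Require Import structures.
From mathcomp Require Import all_boot all_order all_algebra.
From mathcomp Require Import all_classical all_reals all_analysis.
From mathcomp Require Import complex.
Set Implicit Arguments.
Unset Strict Implicit.
Unset Printing Implicit Defensive.
Import Order.TTheory GRing.Theory Num.Theory.
Import numFieldNormedType.Exports.
Local Open Scope classical_set_scope.
Local Open Scope ring_scope.
Local Open Scope complex_scope.

Definition asymp_equiv (K : numFieldType) (u v : nat -> K) : Prop :=
  (u : nat -> K^o) ~_\oo (v : nat -> K^o).

Definition infsum (K : numFieldType) (m0 : nat) (u : nat -> K) : K :=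
  \big[+%R/0]_(m0 <= m <oo) (u m : K^o).

(* (x)_i = x (x + 1) ... (x + i - 1) *)
Definition rfact (K : pzRingType) (x : K) (i : nat) : K :=
  \prod_(j < i) (x + j%:R).

(* n ^ z = exp (z log n) for n > 0 *)
Definition natcpow (R : realType) (n : nat) (z : R[i]) : R[i] :=
  (n%:R `^ complex.Re z)%:C *
  (cos (complex.Im z * ln n%:R) +i* sin (complex.Im z * ln n%:R)).

(* The Gamma function on the whole complex plane minus its poles, by Euler's
   limit formula
     Gamma(z) = lim_n n! n^z / (z (z + 1) ... (z + n));
   a meaningless default value at the poles 0, -1, -2, ... *)
Definition Gamma (R : realType) (z : R[i]) : R[i] :=
  limn ((fun n : nat => n`!%:R * natcpow n z / rfact z n.+1) : nat -> R[i]^o).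

Definition Gamma_pole (R : realType) (z : R[i]) : Prop :=
  exists k : nat, z = - k%:R.

Definition realGamma (R : realType) (x : R) : R := complex.Re (Gamma x%:C).

Definition Beta (R : realType) (z1 z2 : R[i]) : R[i] :=
  Gamma z1 * Gamma z2 / Gamma (z1 + z2).

(* Integral over R^b, as an iterated Lebesgue integral; by Tonelli's theorem
   it is the b-dimensional Lebesgue integral whenever f is measurable and
   nonnegative, as it is below.  Points of R^b are sequences of length b. *)
Fixpoint iter_integral (R : realType) (b : nat) (f : seq R -> \bar R) : \bar R :=
  if b is b'.+1 then
    (\int[@lebesgue_measure R]_y iter_integral b' (fun ys => f (y :: ys)))%E
  else f [::].

Definition Delta (R : realType) (p q : R) : pred (seq R) :=
  fun y => all (fun t => p < t) y && (\sum_(t <- y) t < 1 - q).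

(* As Gamma has no value at 0, nu and rho are meant to be nonzero; where
   Delta_b(p, q) is empty the result is 0 whatever rho is, because the
   integrand vanishes. *)
Definition incDirichlet (R : realType) (b : nat) (p q nu rho : R) : R :=
  if b is 0 then 1 else
  realGamma (rho + b%:R * nu) / (realGamma rho * realGamma nu ^+ b) *
  fine (iter_integral b (fun y : seq R =>
    if Delta p q y then
      ((1 - \sum_(t <- y) t) `^ (rho - 1) * \prod_(t <- y) t `^ (nu - 1))%:E
    else 0%E)).

(* rho_{-1,m}(x).  A term k = m occurs only when x = 1/m, and then
   Delta_m(x, 0) is empty. *)
Definition rho_m1 (R : realType) (m : nat) (x : R) : R :=
  if (Num.ceil x^-1 <= m%:Z)%R then
    \sum_(0 <= k < (Num.truncn x^-1).+1)
      (-1) ^+ k * 'C(m, k)%:R * incDirichlet k x 0 1 (m%:R - k%:R)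
  else 0.

(* mu^{(j)}_{-1,m} *)
Definition mu_m1 (R : realType) (j m : nat) : R :=
  \int[@lebesgue_measure R]_(x in `[0, 1]) (x ^+ j * rho_m1 m x).

Definition gnedin_v (R : realType) (gamma zeta : R) (n k : nat) : R :=
  rfact gamma (n - k) *
  (\prod_(1 <= j < k) (j%:R ^+ 2 - gamma * j%:R + zeta)) /
  (\prod_(1 <= j < n) (j%:R ^+ 2 + gamma * j%:R + zeta)).

Definition gnedin_partition (R : realType) (gamma zeta : R) (n : nat)
    (d : measure_display) (T : measurableType d) (P : probability T R)
    (Pi : T -> {set {set 'I_n}}) : Prop :=
  (forall w, finset.partition (Pi w) [set: 'I_n]%SET) /\
  (forall pi : {set {set 'I_n}}, finset.partition pi [set: 'I_n]%SET ->
     measurable (Pi @^-1` [set pi]) /\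
     P (Pi @^-1` [set pi]) =
       (gnedin_v gamma zeta n #|pi| * \prod_(A in pi) (#|A|)`!%:R)%:E).

Definition largest_block (n : nat) (pi : {set {set 'I_n}}) : nat :=
  \max_(A in pi) #|A|.

(* (s1)_m (s2)_m / (m! (m - 1)!), for m >= 1 *)
Definition gnedin_coef (R : realType) (s1 s2 : R[i]) (m : nat) : R[i] :=
  rfact s1 m * rfact s2 m / (m`!%:R * m.-1`!%:R).

(* Main.v *)
(* Set partitions of [n] into k blocks, weighted by the product of the |A|!,
   are n!/k! times the compositions of n into k parts.  Hence the largest block
   of a Gnedin partition is a mixture, over the number K_n of blocks, of the
   largest part of a uniform composition, whose law is given by
   inclusion-exclusion and converges to the incomplete Dirichlet sum rho.
   The probability that K_n = k is
     block_coef k * block_norm (n - 1) * block_ratio n k,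
   where block_norm n -> zeta B(z1, z2) by Euler's formula for Gamma, and
   block_ratio n k -> 1 for fixed k.  The limit may be taken term by term
   because K_n is tight: the law of K_n for the parameters (gamma / 2, zeta) has
   total mass 1, by an identity on Lah numbers, and its likelihood ratio to the
   law for (gamma, zeta) is at least a function of k that tends to infinity.
   For the moments, summation by parts turns E [L]_j into sums of P(L <= r),
   which are integrals of step functions, and dominated convergence applies. *)

Require Import Defs.
From HB Require Import structures.
From mathcomp Require Import all_boot all_order all_algebra.
From mathcomp Require Import all_classical all_reals all_analysis.
From mathcomp Require Import complex measurable_realfun.
From mathcomp Require Import zify ring lra.
Set Implicit Arguments.
Unset Strict Implicit.
Unset Printing Implicit Defensive.
Import Order.TTheory GRing.Theory Num.Theory.
Import numFieldNormedType.Exports.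
Local Open Scope classical_set_scope.
Local Open Scope ring_scope.
Local Open Scope complex_scope.

(** * Weighted set partitions and compositions *)

(** Asymptotic equivalence to a constant follows from convergence only when the constant is nonzero,
    so each claim also needs a positive limit. For the distribution function, some number of blocks
    must make all parts small with positive probability; for the moments, the single-block event
    must keep positive mass in the limit. Lowering [gamma] works because the total mass is a
    polynomial identity in the parameters, and because both factors of the law that involve [k] grow
    when [gamma] decreases. Support, sign, measurability and a lower bound of the limiting
    distribution functions are read off from the counts of compositions that converge to them, so
    the alternating sum is never manipulated. Only the distribution function for one part has a
    jump: that part equals [n], and [r ~ n] does not decide whether it is at most [r]. This is where
    [x != 1] enters. As [z1] and [z2] may be complex, convergence of Euler's formula is proved from
    relative increments of order 1/n^2, without complex logarithms. *)

Fixpoint compositions (r n k : nat) : nat :=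
  if k is k'.+1 then \sum_(j < n | (j < r)%N) compositions r (n - j.+1) k'
  else (n == 0)%N.

Section partition_weight.
Local Open Scope nat_scope.
Variable T : finType.

Definition partition_with (r k : nat) (D : {set T}) : pred {set {set T}} :=
  fun pi => [&& finset.partition pi D, #|pi| == k & [forall A in pi, #|A| <= r]].

Definition partition_weight (r k : nat) (D : {set T}) : nat :=
  \sum_(pi | partition_with r k D pi) \prod_(A in pi) (#|A|)`!.

Lemma partition_weight0 (r : nat) (D : {set T}) :
  partition_weight r 0 D = (#|D| == 0).
Proof.
rewrite /partition_weight cards_eq0; case: eqP => [->|D0].
  rewrite (big_pred1 finset.set0) /=; first by rewrite big1 // => A; rewrite inE.
  move=> pi.
  rewrite /partition_with partition_set0; apply/idP/idP => [/and3P[]//|].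
  by move=> /eqP->; rewrite cards0 !eqxx /=; apply/forall_inP => A; rewrite inE.
rewrite big_pred0 // => pi; apply/negP => /and3P[piD].
rewrite cards_eq0 => /eqP pi0; move: piD.
rewrite pi0 => /cover_partition covD; case: D0; rewrite -covD.
by rewrite /finset.cover big_pred0 // => A; rewrite inE.
Qed.

(** Stated as an equality of booleans so that deleting a marked block can be read in both directions
    when the double sum is reindexed. *)
Lemma partition_withD1 (r k : nat) (D : {set T}) (pi : {set {set T}}) (A : {set T}) :
  A \in pi ->
  partition_with r k.+1 D pi =
    [&& A \subset D, 0 < #|A| <= r & partition_with r k (D :\: A)%SET (pi :\ A)%SET].
Proof.
move=> Api; apply/idP/idP.
  case/and3P => piD /eqP pik /forall_inP pir.
  have AD := partitionS piD Api.
  rewrite AD card_gt0 (partition_neq0 piD Api) pir //=.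
  apply/and3P; split.
  - exact: partitionD1.
  - by have := cardsD1 A pi; rewrite Api pik => -[->].
  - by apply/forall_inP => B; rewrite !inE => /andP[_ /pir].
case/and3P => AD /andP[A0 Ar] /and3P[piD /eqP pik /forall_inP pir].
have piE : pi = (A |: pi :\ A)%SET by rewrite finset.setD1K.
apply/and3P; split.
- have -> : D = (A :|: (D :\: A))%SET.
    by apply/setP => x; rewrite !inE; case: (boolP (x \in A)) => //= /(fintype.subsetP AD).
  rewrite piE; apply: partitionU1 => //; first by rewrite -card_gt0.
  by rewrite -finset.setI_eq0; apply/eqP/setP => x; rewrite !inE; case: (x \in A).
- by rewrite (cardsD1 A) Api pik.
- apply/forall_inP => B Bpi; case: (B =P A) => [->//|/eqP BA].
  by apply: pir; rewrite !inE BA.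
Qed.

(** Double counting of pairs formed by a partition and one of its blocks: the factor [k.+1] counts
    the choices of the marked block. *)
Lemma partition_weightS (r k : nat) (D : {set T}) :
  k.+1 * partition_weight r k.+1 D =
  \sum_(A : {set T} | (A \subset D) && (0 < #|A| <= r))
     (#|A|)`! * partition_weight r k (D :\: A)%SET.
Proof.
rewrite /partition_weight big_distrr /=.
transitivity (\sum_(pi | partition_with r k.+1 D pi) \sum_(A in pi)
    (#|A|)`! * \prod_(B in (pi :\ A)%SET) (#|B|)`!).
  apply: eq_bigr => pi /and3P[_ /eqP pik _].
  rewrite -pik -sum_nat_const; apply: eq_bigr => A Api.
  by rewrite (big_setD1 A).
rewrite (exchange_big_dep (fun A : {set T} => (A \subset D) && (0 < #|A| <= r))) /=; last first.
  by move=> pi A pik Api; move: pik; rewrite (partition_withD1 _ _ _ Api) => /and3P[-> ->].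
apply: eq_bigr => A /andP[AD A0r]; rewrite big_distrr /=.
have A0 : A != finset.set0 by rewrite -card_gt0; case/andP: A0r.
(* A nonempty [A] cannot be a block of a partition of its complement, so adding and then deleting
   [A] is the identity. *)
have AnD pi : partition_with r k (D :\: A)%SET pi -> A \notin pi.
  case/and3P => piD _ _; apply/negP => Api.
  have /fintype.subsetP sub := partitionS piD Api.
  by case/set0Pn: A0 => x xA; have := sub x xA; rewrite !inE xA.
rewrite (reindex_onto (fun pi => A |: pi)%SET (fun pi => pi :\ A)%SET) /=; last first.
  by move=> pi /andP[_ Api]; rewrite finset.setD1K.
apply: eq_big => [pi|pi /andP[_ /eqP->] //].
rewrite finset.setU11 andbT; apply/andP/idP => [[H /eqP E]|H].
  by move: H; rewrite (partition_withD1 _ _ _ (finset.setU11 _ _)) E => /and3P[].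
have E : (A |: pi)%SET :\ A = pi by rewrite finset.setU1K // (AnD _ H).
by rewrite (partition_withD1 _ _ _ (finset.setU11 _ _)) E AD A0r H.
Qed.

(* Marking a block of the partition replaces a bijection between set partitions
   and compositions by the recursion [partition_weightS]. *)
Lemma partition_weightE (r k : nat) (D : {set T}) :
  k`! * partition_weight r k D = (#|D|)`! * compositions r #|D| k.
Proof.
elim: k D => [|k IH] D.
  by rewrite partition_weight0 /= fact0 mul1n; case: eqP => [->|]; rewrite ?muln0.
rewrite factS mulnAC partition_weightS mulnC big_distrr /=.
transitivity (\sum_(A : {set T} | (A \subset D) && (0 < #|A| <= r))
    (#|A|)`! * (#|D| - #|A|)`! * compositions r (#|D| - #|A|) k).
  apply: eq_bigr => A /andP[AD _]; rewrite mulnCA IH.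
  by rewrite cardsD (finset.setIidPr AD) mulnA.
(* Marked blocks are grouped by size: the binomial number of blocks of a given size, times the two
   factorials, is the factorial of #|D|. *)
rewrite (partition_big (fun A : {set T} => (inord #|A| : 'I_#|D|.+1))
  (fun i : 'I_#|D|.+1 => 0 < i <= r)) /=; last first.
  by move=> A /andP[AD A0r]; rewrite inordK // ltnS subset_leq_card.
rewrite big_mkcond big_ord_recl /= add0n [RHS]big_distrr [RHS]big_mkcond; apply: eq_bigr => i _.
rewrite /bump /= !add1n; case: ifP => // ir.
have iD : i.+1 <= #|D| by [].
rewrite (eq_bigl (fun A : {set T} => A \in [set A : {set T} | A \subset D & #|A| == i.+1])); last first.
  move=> A; rewrite inE; case: (boolP (A \subset D)) => //= AD.
  rewrite -val_eqE /= inordK ?ltnS ?subset_leq_card // /bump /= add1n.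
  by case: eqP => [->|//]; rewrite ?ir ?andbF.
rewrite (eq_bigr (fun=> (i.+1)`! * (#|D| - i.+1)`! * compositions r (#|D| - i.+1) k)); last first.
  by move=> A; rewrite inE => /andP[_ /eqP->].
by rewrite sum_nat_const cards_draws mulnA mulnA -(bin_fact iD) mulnA.
Qed.
End partition_weight.

(** The factor [(0 < n)] corrects [n = 0], where the truncated predecessor would count one
    composition of 0 into one part. *)
Definition all_compositions (n k : nat) : nat :=
  if k is k'.+1 then ((0 < n) * 'C(n.-1, k'))%N else (n == 0)%N.

(** Pascal's rule: the first part is 1 and is removed, or is larger and is decreased by 1. *)
Lemma all_compositions_step (k n : nat) :
  all_compositions n.+1 k.+1 = (all_compositions n k + all_compositions n k.+1)%N.
Proof. by case: k => [|k]; case: n => [|n] //=; rewrite !mul1n ?bin0 // binS addnC. Qed.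

(* The side condition excludes [k = 0] with [N] truncated. *)
Lemma sum_all_compositions (r n N k : nat) : (N <= n)%N -> (0 < k)%N || (N == n) ->
  (\sum_(j < n | (j < r)%N) all_compositions (N - j.+1) k
    + all_compositions (N - r) k.+1 = all_compositions N k.+1)%N.
Proof.
move=> Nn kN; elim: r => [|r <-]; first by rewrite big_pred0 // subn0.
have [rN|Nr] := ltnP r N; last first.
  have -> : (N - r.+1 = 0)%N by lia.
  have -> : (N - r = 0)%N by lia.
  congr (_ + _)%N; rewrite [LHS]big_mkcond [RHS]big_mkcond; apply: eq_bigr => j _.
  rewrite ltnS leq_eqVlt; case: (j =P r :> nat) => [jr|//]; rewrite jr ltnn /=.
  have -> : (N - r.+1 = 0)%N by lia.
  by have jn := ltn_ord j; case: k kN => //= /eqP ?; lia.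
have rn : (r < n)%N by lia.
rewrite (bigD1 (Ordinal rn)) // (eq_bigl (fun j : 'I_n => (j < r)%N)); last first.
  by move=> j; rewrite -val_eqE /= ltnS ltn_neqAle andbC.
have -> : (N - r = (N - r.+1).+1)%N by lia.
by rewrite all_compositions_step -addnA addnCA.
Qed.

Lemma leq_compositions (r n k : nat) :
  (compositions r n k <= all_compositions n k)%N.
Proof.
elim: k n => [|k IH] n //; rewrite [compositions _ _ _]/=.
have := @sum_all_compositions r n n k (leqnn _); rewrite eqxx orbT => /(_ isT) <-.
by apply: leq_trans (leq_addr _ _); apply: leq_sum => j _; exact: IH.
Qed.

(** Bounding one part by [r] replaces a count by its difference with the count for the total lowered
    by [r]. Bounding all [k] parts applies this difference [k] times, and the binomial expansion is
    built by Pascal's rule in the induction. *)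
Lemma compositions_incl_excl (R : comPzRingType) (r n k : nat) :
  (compositions r n k)%:R =
  \sum_(i < k.+1) (-1) ^+ i * 'C(k, i)%:R * (all_compositions (n - i * r) k)%:R :> R.
Proof.
elim: k n => [|k IH] n.
  by rewrite big_ord1 /= mul0n subn0 bin0 expr0 !mul1r.
rewrite [compositions _ _ _]/= natr_sum.
under eq_bigr => j _ do rewrite IH.
rewrite exchange_big /=.
pose F i : R := (all_compositions (n - i * r) k.+1)%:R.
transitivity (\sum_(i < k.+1) (-1) ^+ i * 'C(k, i)%:R * (F i - F i.+1)).
  apply: eq_bigr => i _; rewrite -mulr_sumr; congr (_ * _).
  under eq_bigr => j _ do rewrite subnAC.
  rewrite -natr_sum /F -(@sum_all_compositions r n (n - i * r) k); last 2 first.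
  - exact: leq_subr.
  - by case: k {IH F} i => //= i; rewrite ord1 mul0n subn0.
  by rewrite natrD mulSn subnDA subnAC addrK.
transitivity (\sum_(i < k.+2) (-1) ^+ i * 'C(k.+1, i)%:R * F i); last by [].
clearbody F.
rewrite [RHS]big_ord_recl bin0.
under [in RHS]eq_bigr => i _ do rewrite lift0 binS natrD mulrDr mulrDl.
rewrite big_split [X in _ = _ + (X + _)]big_ord_recr /= [in RHS]bin_small // mulr0 mul0r addr0.
under eq_bigr => i _ do rewrite mulrBr.
rewrite sumrB big_ord_recl bin0 -addrA; congr (_ + (_ + _)).
rewrite -sumrN; apply: eq_bigr => i _; rewrite exprS; ring.
Qed.

Definition lah (R : unitRingType) (n k : nat) : R :=
  n`!%:R / k`!%:R * (all_compositions n k)%:R.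

Lemma lahn0 (R : unitRingType) (n : nat) : lah R n.+1 0 = 0.
Proof. by rewrite /lah /= mulr0. Qed.

Lemma lah_small (R : unitRingType) (n k : nat) : (n < k)%N -> lah R n k = 0.
Proof.
case: n k => [|n] [|k] // nk; rewrite /lah /= ?mulr0 //.
by rewrite bin_small // muln0 mulr0.
Qed.

(** A new element is inserted at one of the n + k + 1 places in k + 1 nonempty lists of total length
    n, or forms a list of its own. *)
Lemma lahS (R : numFieldType) (n k : nat) : (0 < n)%N ->
  lah R n.+1 k.+1 = (n + k.+1)%:R * lah R n k.+1 + lah R n k.
Proof.
case: n => // n _; rewrite /lah.
have f0 m : (m`!)%:R != 0 :> R by rewrite pnatr_eq0 -lt0n fact_gt0.
case: k => [|k].
  by rewrite /= !bin0 !muln1 factS natrM addn1 !mulr1 mulr0 addr0 mulrA.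
(* Absorption expresses one binomial through its neighbour, after which the recurrence is an
   identity of rational functions. *)
have H : (n%:R - k%:R) * 'C(n, k)%:R = k.+1%:R * 'C(n, k.+1)%:R :> R.
  have [kn|nk] := leqP k n; last by rewrite !bin_small ?mulr0 // ltnW.
  by rewrite -natrB // -!natrM mul_bin_left.
have k1 : k.+2%:R != 0 :> R by rewrite pnatr_eq0.
have := f0 k.+1; set a := (k.+1)`!%:R => a0; pose b : R := (n.+1)`!%:R.
have -> : n.+2`!%:R / k.+2`!%:R * (all_compositions n.+2 k.+2)%:R =
    n.+2%:R * b / (k.+2%:R * a) * ('C(n, k.+1)%:R + 'C(n, k)%:R) :> R.
  by rewrite [all_compositions _ _]/= mul1n binS (factS n.+1) (factS k.+1) natrD
    (natrM _ n.+2) (natrM _ k.+2).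
have -> : n.+1`!%:R / k.+2`!%:R * (all_compositions n.+1 k.+2)%:R =
    b / (k.+2%:R * a) * 'C(n, k.+1)%:R :> R.
  by rewrite [all_compositions _ _]/= mul1n (factS k.+1) (natrM _ k.+2).
have -> : n.+1`!%:R / k.+1`!%:R * (all_compositions n.+1 k.+1)%:R =
    b / a * 'C(n, k)%:R :> R.
  by rewrite [all_compositions _ _]/= mul1n.
clearbody a b.
have k2 : k.+1%:R != 0 :> R by rewrite pnatr_eq0.
have -> : (n.+1 + k.+2)%:R = n%:R + k%:R + 3 :> R.
  by rewrite -natrD -(natrD _ _ 3); congr (_%:R); lia.
move: H k1 k2; rewrite -[k.+2]addn2 -[n.+2]addn2 -[k.+1]addn1 !natrD.
move: (n%:R : R) (k%:R : R) ('C(n, k)%:R : R) ('C(n, k + 1)%:R : R) => N K C0 C1 H k1 k2.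
have -> : C1 = (N - K) * C0 / (K + 1) by rewrite H; field.
by field; rewrite a0 k1 k2.
Qed.

(** Passing from N to N + 1 by [lahS] multiplies the coefficient of L(N, k) by (gamma + N - k)(N +
    k) + k^2 - gamma k + zeta. This equals N^2 + gamma N + zeta, which is free of k and leaves the
    sum. *)
Lemma sum_lah (R : numFieldType) (gamma zeta : R) (n : nat) : (0 < n)%N ->
  \sum_(k < n.+1) rfact gamma (n - k) *
     (\prod_(1 <= j < k) (j%:R ^+ 2 - gamma * j%:R + zeta)) * lah R n k =
  \prod_(1 <= j < n) (j%:R ^+ 2 + gamma * j%:R + zeta).
Proof.
elim: n => // -[_ _|n IH _].
  rewrite !big_ord_recl big_ord0 /= !big_geq // /lah /rfact big_ord0 /= bin0.
  by rewrite /bump /= muln1 !mulr0 add0r addr0 !mulr1 mul1r divr1.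
rewrite big_nat_recr //= -IH // mulr_suml big_ord_recl /=.
pose V m k : R := rfact gamma (m - k) *
     (\prod_(1 <= j < k) (j%:R ^+ 2 - gamma * j%:R + zeta)).
rewrite -/(V _ 0%N) lahn0 mulr0 add0r.
transitivity (\sum_(i < n.+2) (V n.+2 i.+1 * ((n.+1 + i.+1)%:R * lah R n.+1 i.+1)
   + V n.+2 i.+1 * lah R n.+1 i)).
  by apply: eq_bigr => i _; rewrite /bump leq0n add1n lahS // mulrDr.
rewrite big_split [X in X + _ = _]big_ord_recr /= [lah R n.+1 n.+2]lah_small // !mulr0 addr0.
transitivity (\sum_(i < n.+2) V n.+2 i * ((n.+1 + i)%:R * lah R n.+1 i) +
   \sum_(i < n.+2) V n.+2 i.+1 * lah R n.+1 i).
  by rewrite [X in _ = X + _]big_ord_recl lahn0 !mulr0 add0r.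
rewrite -big_split /=; apply: eq_bigr => -[[|k] /= kn] _.
  by rewrite lahn0 !(mulr0, mul0r) add0r.
rewrite -/(V n.+1 k.+1) mulrA -mulrDl [RHS]mulrAC; congr (_ * _).
rewrite /V [in X in _ + X]big_nat_recr //=.
have -> : (n.+2 - k.+1 = (n.+1 - k.+1).+1)%N by lia.
have -> : (n.+2 - k.+2 = n.+1 - k.+1)%N by lia.
rewrite /rfact big_ord_recr /= natrB; last by lia.
rewrite natrD.
ring.
Qed.

(** * The law of the number of blocks *)

Section weights.
Variable R : realType.
Implicit Types (g z : R) (n k : nat).

Definition neg_prod g z k : R := \prod_(1 <= j < k) (j%:R ^+ 2 - g * j%:R + z).
Definition pos_prod g z n : R := \prod_(1 <= j < n) (j%:R ^+ 2 + g * j%:R + z).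

Definition block_coef g z k : R := neg_prod g z k / (k`!%:R * k.-1`!%:R).

(** Indexed like Euler's products for Gamma, with [n.+1] factors; this is why the law on [n]
    involves it at [n.-1]. *)
Definition block_norm g z n : R := n`!%:R * rfact g n.+1 / pos_prod g z n.+1.

(** For [k <= n] this is n^_k (g)_(n-k) / (g)_n, written as [k] factors that each tend to 1. For
    [k > n] the factor [i = n] makes it 0. *)
Definition block_ratio g n k : R :=
  \prod_(i < k) ((n%:R - i%:R) / (g + (n%:R - i%:R) - 1)).

(* The law of the number of blocks; [lah n k] is the sum, over the set
   partitions of [n] into [k] blocks, of the product of the [|A|!]. *)
Definition block_law g z n k : R := gnedin_v g z n k * lah R n k.

Definition admissible g z := forall j, (1 <= j)%N -> 0 < j%:R ^+ 2 - g * j%:R + z.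

Lemma rfactS g n : rfact g n.+1 = rfact g n * (g + n%:R).
Proof. by rewrite /rfact big_ord_recr. Qed.

Lemma rfact_gt0 g n : 0 < g -> 0 < rfact g n.
Proof. by move=> g0; apply: prodr_gt0 => i _; rewrite ltr_wpDr. Qed.

Lemma neg_prod_gt0 g z k : admissible g z -> 0 < neg_prod g z k.
Proof.
move=> adm; rewrite /neg_prod big_nat_cond; apply: prodr_gt0 => i.
by rewrite andbT => /andP[i1 _]; exact: adm.
Qed.

Lemma admissible_pos g z j : 0 <= g -> admissible g z -> (1 <= j)%N ->
  0 < j%:R ^+ 2 + g * j%:R + z.
Proof.
move=> g0 adm j1; apply: lt_le_trans (adm j j1) _.
by rewrite lerD2r lerD2l -mulNr ler_wpM2r // (le_trans _ g0) // oppr_le0.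
Qed.

Lemma pos_prod_gt0 g z n : 0 <= g -> admissible g z -> 0 < pos_prod g z n.
Proof.
move=> g0 adm; rewrite /pos_prod big_nat_cond; apply: prodr_gt0 => i.
by rewrite andbT => /andP[i1 _]; exact: admissible_pos.
Qed.

Lemma block_coef_gt0 g z k : admissible g z -> 0 < block_coef g z k.
Proof.
by move=> adm; rewrite divr_gt0 ?neg_prod_gt0 // mulr_gt0 // ltr0n fact_gt0.
Qed.

Lemma block_norm_gt0 g z n : 0 < g -> admissible g z -> 0 < block_norm g z n.
Proof.
move=> g0 adm; rewrite divr_gt0 ?pos_prod_gt0 ?(ltW g0) //.
by rewrite mulr_gt0 ?rfact_gt0 // ltr0n fact_gt0.
Qed.

Lemma block_ratioS g n k : block_ratio g n k.+1 =
  block_ratio g n k * ((n%:R - k%:R) / (g + (n%:R - k%:R) - 1)).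
Proof. by rewrite /block_ratio big_ord_recr. Qed.

Lemma block_ratio_small g n k : (n < k)%N -> block_ratio g n k = 0.
Proof.
by move=> nk; rewrite /block_ratio (bigD1 (Ordinal nk)) //= subrr mul0r mul0r.
Qed.

Lemma block_ratioE g n k : 0 < g -> (k <= n)%N ->
  block_ratio g n k * rfact g n = (n ^_ k)%:R * rfact g (n - k).
Proof.
move=> g0; elim: k => [|k IH] kn.
  by rewrite /block_ratio big_ord0 ffactn0 subn0.
rewrite block_ratioS mulrAC IH ?(ltnW kn) //.
have nk : (n - k = (n - k.+1).+1)%N by lia.
rewrite nk rfactS ffactnSr natrM natrB ?(ltnW kn) //.
have -> : g + (n%:R - k%:R) - 1 = g + (n - k.+1)%:R.
  by rewrite -natrB ?(ltnW kn) // nk -natr1 addrA addrK.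
by field; rewrite gt_eqF // ltr_wpDr.
Qed.

Lemma lahE n k : (0 < n)%N -> (0 < k)%N ->
  lah R n k = (n.-1)`!%:R * (n ^_ k)%:R / (k`!%:R * k.-1`!%:R).
Proof.
case: n => // n _; case: k => // k _; rewrite /lah [all_compositions _ _]/= mul1n.
have f0 m : (m`!)%:R != 0 :> R by rewrite pnatr_eq0 -lt0n fact_gt0.
rewrite ffactSS -bin_ffact [k.+1.-1]/= [n.+1.-1]/= (factS n).
move: (f0 k.+1) (f0 k); move: (k.+1`!) (k`!) => a b a0 b0.
by rewrite !natrM; field; rewrite a0 b0.
Qed.

Lemma block_lawE g z n k : 0 < g -> admissible g z -> (0 < n)%N -> (0 < k)%N ->
  block_law g z n k = block_coef g z k * block_norm g z n.-1 * block_ratio g n k.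
Proof.
move=> g0 adm n0 k0; have [nk|kn] := ltnP n k.
  by rewrite /block_law lah_small // block_ratio_small // !mulr0.
have rn := lt0r_neq0 (rfact_gt0 n g0).
apply: (mulIf rn); rewrite -[RHS]mulrA block_ratioE // /block_law lahE // /gnedin_v.
rewrite /block_coef /block_norm prednK // -/(neg_prod g z k) -/(pos_prod g z n).
have pn := lt0r_neq0 (pos_prod_gt0 n (ltW g0) adm).
have f0 m : (m`!)%:R != 0 :> R by rewrite pnatr_eq0 -lt0n fact_gt0.
by field; rewrite !f0 pn.
Qed.

Lemma block_law0 g z n : (0 < n)%N -> block_law g z n 0 = 0.
Proof. by case: n => // n _; rewrite /block_law lahn0 mulr0. Qed.

Lemma block_ratio_ge0 g n k : 0 < g -> 0 <= block_ratio g n k.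
Proof.
move=> g0; have [nk|kn] := ltnP n k; first by rewrite block_ratio_small.
apply: prodr_ge0 => i _; have ik := ltn_ord i.
have ni : 1 <= n%:R - i%:R :> R by rewrite -natrB ?ler1n; lia.
by rewrite divr_ge0 //; lra.
Qed.

Lemma block_law_ge0 g z n k : 0 < g -> admissible g z -> 0 <= block_law g z n k.
Proof.
move=> g0 adm; rewrite /block_law /gnedin_v mulr_ge0 //.
  rewrite divr_ge0 ?(ltW (pos_prod_gt0 _ (ltW g0) adm)) //.
  by rewrite mulr_ge0 ?(ltW (rfact_gt0 _ g0)) ?(ltW (neg_prod_gt0 _ adm)).
by rewrite /lah mulr_ge0 // divr_ge0.
Qed.

Lemma sum_block_law g z n : 0 < g -> admissible g z -> (0 < n)%N ->
  \sum_(k < n.+1) block_law g z n k = 1.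
Proof.
move=> g0 adm n0; have pn := lt0r_neq0 (pos_prod_gt0 n (ltW g0) adm).
apply: (mulIf pn); rewrite mul1r {2}/pos_prod -(sum_lah g z n0) mulr_suml.
apply: eq_bigr => k _; rewrite /block_law /gnedin_v -/(pos_prod g z n).
by field.
Qed.

Lemma ler_block_ratio g g' n k : 0 < g' -> g' <= g ->
  block_ratio g n k <= block_ratio g' n k.
Proof.
move=> g0 gg; have [nk|kn] := ltnP n k; first by rewrite !block_ratio_small.
apply: ler_prod => i _; have ik := ltn_ord i.
have ni : 1 <= n%:R - i%:R :> R by rewrite -natrB ?ler1n; lia.
apply/andP; split; first by rewrite divr_ge0 //; lra.
by rewrite ler_wpM2l ?lef_pV2 ?posrE; lra.
Qed.

(** The inverse is g^-1 times the product of the 1 + z / (N (g + N)), and each factor is at most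
    exp(|z| / N^2). The bound serves the tail estimate at [g / 2] and the positivity of the limit of
    [block_norm]. *)
Lemma block_norm_inv_le g z n : 0 < g -> admissible g z ->
  (block_norm g z n)^-1 <= g^-1 * expR (2 * `|z|).
Proof.
move=> g0 adm.
(* The exponent is chosen to telescope: its increment 2|z| / (N (N + 1)) dominates |z| / N^2 for N
   >= 1. *)
suff H : (block_norm g z n)^-1 <= g^-1 * expR (2 * `|z| * (1 - n.+1%:R^-1)).
  apply: le_trans H _; rewrite ler_pM2l ?invr_gt0 // ler_expR.
  by rewrite ler_piMr ?mulr_ge0 // gerBl invr_ge0.
elim: n => [|n IH].
  rewrite /block_norm /pos_prod big_geq // rfactS /rfact big_ord0 fact0.
  by rewrite !mul1r addr0 divr1 invr1 subrr mulr0 expR0 mulr1.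
have n1 : 0 < n.+1%:R :> R by rewrite ltr0n.
have -> : (block_norm g z n.+1)^-1 = (block_norm g z n)^-1 *
    ((n.+1%:R ^+ 2 + g * n.+1%:R + z) / (n.+1%:R * (g + n.+1%:R))).
  rewrite /block_norm rfactS factS natrM /pos_prod big_nat_recr //= -/(pos_prod _ _ _).
  have P0 := lt0r_neq0 (pos_prod_gt0 n.+1 (ltW g0) adm).
  have P1 := lt0r_neq0 (admissible_pos (ltW g0) adm (isT : (1 <= n.+1)%N)).
  have f0 : (n`!)%:R != 0 :> R by rewrite pnatr_eq0 -lt0n fact_gt0.
  have r0 := lt0r_neq0 (rfact_gt0 n.+1 g0).
  have s0 : g + n.+1%:R != 0 by apply: lt0r_neq0; lra.
  move: P1 s0 n1; set N := n.+1%:R => P1 s0 n1.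
  clearbody N.
  by field; rewrite f0 s0 P0 P1 r0 gt_eqF.
set N : R := n.+1%:R in n1 IH *.
have N1 : 1 <= N by rewrite /N ler1n.
have -> : n.+2%:R = N + 1 :> R by rewrite /N natr1.
have S0 : 0 < (N ^+ 2 + g * N + z) / (N * (g + N)).
  by rewrite divr_gt0 ?(admissible_pos (ltW g0) adm) // mulr_gt0 //; lra.
apply: le_trans (ler_pM _ (ltW S0) IH _) _.
- by rewrite invr_ge0 ltW // block_norm_gt0.
- apply: (le_trans _ (expR_ge1Dx (`|z| / N ^+ 2))).
  rewrite ler_pdivrMr; last by rewrite mulr_gt0 //; lra.
  have -> : (1 + `|z| / N ^+ 2) * (N * (g + N)) = N ^+ 2 + g * N + `|z| * (1 + g / N).
    by field; rewrite gt_eqF.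
  rewrite lerD2l; apply: le_trans (ler_norm z) _.
  by rewrite ler_peMr // lerDl divr_ge0 // ltW.
rewrite -[leLHS]mulrA ler_pM2l ?invr_gt0 // -expRD ler_expR -subr_ge0.
have -> : 2 * `|z| * (1 - (N + 1)^-1) - (2 * `|z| * (1 - N^-1) + `|z| / N ^+ 2) =
   `|z| * ((N - 1) / (N ^+ 2 * (N + 1))).
  by field; rewrite !gt_eqF //; lra.
by rewrite mulr_ge0 // divr_ge0 // ?mulr_ge0 ?exprn_ge0 //; lra.
Qed.
End weights.

Lemma cvg_natDV (R : realType) (c : R) :
  (fun n : nat => (n%:R + c)^-1) @ \oo --> (0 : R).
Proof.
have cy : (fun n : nat => n%:R + c) @ \oo --> (+oo : set_system R).
  by apply/cvgryPge => A; near=> n; rewrite -lerBlDr; near: n; exact: nbhs_infty_ger.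
apply/gtr0_cvgV0 => //; near=> n.
by rewrite -ltrBlDr; near: n; exact: nbhs_infty_gtr.
Unshelve. all: by end_near. Qed.

Lemma cvg_block_ratio (R : realType) (g : R) (k : nat) :
  (fun n => block_ratio g n k) @ \oo --> (1 : R).
Proof.
elim: k => [|k IH].
  rewrite (_ : (fun n => _) = fun=> 1); first exact: cvg_cst.
  by apply/funext => n; rewrite /block_ratio big_ord0.
rewrite (_ : (fun n => _) = fun n => block_ratio g n k *
   ((n%:R - k%:R) / (g + (n%:R - k%:R) - 1))); last by apply/funext => n; rewrite block_ratioS.
rewrite -[X in _ --> X](mulr1 (1 : R)); apply: cvgM => //.
apply: (@cvg_trans _ ((fun n : nat => 1 - (g - 1) * (n%:R + (g - k%:R - 1))^-1) @ \oo)).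
  apply: near_eq_cvg; near=> n.
  have n0 : 0 < n%:R + (g - k%:R - 1).
    by rewrite -ltrBlDr; near: n; exact: nbhs_infty_gtr.
  by field; rewrite gt_eqF //; lra.
have := cvgB (cvg_cst (1 : R)) (cvgM (cvg_cst (g - 1)) (cvg_natDV (g - k%:R - 1))).
by rewrite mulr0 subr0; apply.
Unshelve. all: by end_near. Qed.

(** * Tightness of the number of blocks *)

Section tightness.
Variables (R : realType) (g z : R).
Hypotheses (g0 : 0 < g) (adm : admissible g z).

(** Any value strictly between 0 and [g] would serve: positive to keep [block_norm g' z] positive,
    and smaller than [g] so that the likelihood ratio diverges. *)
Let g' := g / 2.

Let half_le : g' <= g.
Proof. by rewrite /g' ler_pdivrMr // ler_peMr ?(ltW g0) // ler1n. Qed.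

Lemma admissible_half : admissible g' z.
Proof.
move=> j j1; apply: lt_le_trans (adm j1) _.
rewrite lerD2r lerD2l lerN2 ler_wpM2r //; exact: half_le.
Qed.

(* The part of the ratio of the two laws that depends on [k] alone. *)
Let phi k := neg_prod g' z k / neg_prod g z k.

Lemma phi_gt0 k : 0 < phi k.
Proof. by rewrite divr_gt0 ?neg_prod_gt0 //; exact: admissible_half. Qed.

Lemma phiS k : (0 < k)%N ->
  phi k.+1 = phi k * (1 + g / 2 * k%:R / (k%:R ^+ 2 - g * k%:R + z)).
Proof.
move=> k0; rewrite /phi /neg_prod !big_nat_recr //= -/(neg_prod _ _ _) -/(neg_prod g _ _).
have P0 := lt0r_neq0 (neg_prod_gt0 k adm).
have P1 := lt0r_neq0 (adm k0).
by rewrite /g'; field; rewrite P0 P1.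
Qed.

Lemma phi_nondecreasing m n : (0 < m <= n)%N -> phi m <= phi n.
Proof.
case/andP => m0; elim: n => [|n IH]; first by rewrite leqn0 => /eqP->.
rewrite leq_eqVlt => /predU1P[->//|mn]; apply: le_trans (IH mn) _.
have n0 : (0 < n)%N := leq_trans m0 mn.
rewrite phiS // ler_peMr ?(ltW (phi_gt0 _)) // lerDl divr_ge0 ?(ltW (adm n0)) //.
by rewrite mulr_ge0 // divr_ge0 // ltW.
Qed.

(* [phi k] dominates a multiple of the harmonic sum. *)
Lemma phi_unbounded (A : R) : exists2 k, (0 < k)%N & A <= phi k.
Proof.
apply: contrapT => nE.
have ub k : (0 < k)%N -> phi k < A.
  by move=> k0; rewrite ltNge; apply/negP => Ak; apply: nE; exists k.
(* For K >= 1 the denominator K^2 - g K + z is at most K^2 (1 + |z|). As [phi >= 1], each increment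
   of [phi] is then at least c / K. *)
pose c : R := g / 2 / (1 + `|z|).
have z1 : 0 < 1 + `|z| by rewrite ltr_wpDr.
have c0 : 0 < c by rewrite !divr_gt0.
have phi1 k : (0 < k)%N -> 1 <= phi k.
  move=> k0; apply: le_trans (phi_nondecreasing (m := 1) _) => //.
  by rewrite /phi /neg_prod !big_geq // divr1.
have le_sum k : 1 + c * series harmonic k <= phi k.+1.
  elim: k => [|k IH].
    by rewrite /series /= big_geq // mulr0 addr0 phi1.
  rewrite /series /= big_nat_recr //= -/(series harmonic k) phiS //.
  rewrite mulrDr addrA mulrDr mulr1 lerD //.
  have K0 : 0 < k.+1%:R :> R by [].
  have K1 : 1 <= k.+1%:R :> R by rewrite ler1n.
  have D0 := adm (isT : (1 <= k.+1)%N).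
  set K := k.+1%:R in K0 K1 D0 *.
  apply: (@le_trans _ _ (g / 2 * K / (K ^+ 2 - g * K + z))); last first.
    rewrite ler_peMl ?phi1 // divr_ge0 ?(ltW D0) // mulr_ge0 ?divr_ge0 ?(ltW g0) ?(ltW K0) //.
  have -> : c * K^-1 = g / 2 * K / (K ^+ 2 * (1 + `|z|)).
    by rewrite /c; field; rewrite !gt_eqF.
  rewrite ler_wpM2l ?mulr_ge0 ?divr_ge0 ?(ltW g0) ?(ltW K0) //.
  rewrite lef_pV2 ?posrE ?mulr_gt0 ?exprn_gt0 //.
  apply: (@le_trans _ _ (K ^+ 2 + `|z|)).
    by rewrite lerD ?ler_norm // gerBl mulr_ge0 // ltW.
  by rewrite mulrDr mulr1 lerD2l ler_peMl // exprn_ege1.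
apply: (@dvg_harmonic R); apply: nondecreasing_is_cvgn.
  by apply: nondecreasing_series => k _ _; exact: harmonic_ge0.
exists (A / c) => _ [k _ <-].
rewrite ler_pdivlMr // mulrC; apply: ltW; apply: le_lt_trans (ub k.+1 isT).
by apply: le_trans (le_sum k); rewrite lerDr.
Qed.

(** Change of measure: for k >= M the law at [g] is at most the law at [g / 2] times the quotient of
    the two norms over [phi M], and the law at [g / 2] has mass 1. *)
Lemma block_law_tail_le M n : (0 < M)%N -> (0 < n)%N ->
  \sum_(M <= k < n.+1) block_law g z n k <=
    block_norm g z n.-1 * ((g / 2)^-1 * expR (2 * `|z|)) / phi M.
Proof.
move=> M0 n0.
have g'0 : 0 < g' by rewrite divr_gt0.
have B0 := block_norm_gt0 n.-1 g0 adm.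
have B'0 := block_norm_gt0 n.-1 g'0 admissible_half.
rewrite ler_pdivlMr ?phi_gt0 //.
apply: (@le_trans _ _ (block_norm g z n.-1 / block_norm g' z n.-1)); last first.
  by rewrite ler_pM2l // block_norm_inv_le //; exact: admissible_half.
rewrite ler_pdivlMr // mulrAC mulr_suml mulr_suml.
apply: (@le_trans _ _ (\sum_(M <= k < n.+1) block_norm g z n.-1 * block_law g' z n k)).
  rewrite big_nat_cond [leRHS]big_nat_cond.
  apply: ler_sum => k; rewrite andbT => /andP[Mk _].
  have k0 : (0 < k)%N := leq_trans M0 Mk.
  rewrite !block_lawE //; last exact: admissible_half.
  have -> : block_coef g' z k = phi k * block_coef g z k.
    rewrite /phi /block_coef; field.
    by rewrite !pnatr_eq0 -!lt0n !fact_gt0 gt_eqF ?neg_prod_gt0.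
  rewrite -subr_ge0.
  have -> : block_norm g z n.-1 * (phi k * block_coef g z k * block_norm g' z n.-1 * block_ratio g' n k) -
     block_coef g z k * block_norm g z n.-1 * block_ratio g n k * block_norm g' z n.-1 * phi M =
     block_norm g z n.-1 * block_coef g z k * block_norm g' z n.-1 *
       (phi k * block_ratio g' n k - phi M * block_ratio g n k) by ring.
  apply: mulr_ge0.
    by rewrite ltW // mulr_gt0 // mulr_gt0 // block_coef_gt0.
  rewrite subr_ge0 ler_pM ?(ltW (phi_gt0 _)) ?block_ratio_ge0 //.
    by rewrite phi_nondecreasing // M0.
  by rewrite ler_block_ratio.
rewrite -mulr_sumr ler_piMr ?(ltW B0) //.
rewrite -(sum_block_law g'0 admissible_half n0) -(big_mkord xpredT (block_law g' z n)).
have [Mn|nM] := leqP M n.+1; last first.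
  rewrite [leLHS]big_geq ?(ltnW nM) //.
  apply: sumr_ge0 => i _.
  by apply: block_law_ge0 => //; exact: admissible_half.
rewrite (big_cat_nat (leq0n M) Mn) /= lerDr; apply: sumr_ge0 => i _.
by apply: block_law_ge0 => //; exact: admissible_half.
Qed.

Lemma block_law_tight (e : R) : 0 < e -> cvgn (block_norm g z) ->
  exists M, \forall n \near \oo, \sum_(M <= k < n.+1) block_law g z n k <= e.
Proof.
move=> e0 cvB.
have [C C0 HC] : exists2 C : R, 0 < C & forall n, block_norm g z n <= C.
  have [C [_ HC]] := cvg_seq_bounded cvB.
  exists (`|C| + 1); first by rewrite ltr_wpDl.
  move=> n; apply: le_trans (ler_norm _) _; apply: (HC (`|C| + 1)) => //.
  by rewrite (le_lt_trans (ler_norm _)) // ltrDl.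
(* Convergence of [block_norm] supplies the bound [C], so the tails are at most K / phi M uniformly
   in [n]. *)
pose K := C * ((g / 2)^-1 * expR (2 * `|z|)).
have [M M0 HM] := phi_unbounded (K / e).
exists M; near=> n.
apply: le_trans (block_law_tail_le M0 _) _; first by near: n; exists 1%N.
rewrite ler_pdivrMr ?phi_gt0 //.
apply: (@le_trans _ _ K).
  by rewrite ler_wpM2r ?HC // mulr_ge0 ?expR_ge0 // invr_ge0 divr_ge0 // ltW.
by move: HM; rewrite ler_pdivrMr // mulrC.
Unshelve. all: by end_near. Qed.
End tightness.

(** * Term by term limits *)

Lemma cvgn_sum (R : realType) (I : Type) (r : seq I) (u : I -> nat -> R) (l : I -> R) :
  (forall i, u i @ \oo --> l i) ->
  (fun n => \sum_(i <- r) u i n) @ \oo --> \sum_(i <- r) l i.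
Proof.
move=> ul; elim: r => [|i r IH].
  rewrite big_nil (_ : (fun n => _) = fun=> 0); first exact: cvg_cst.
  by apply/funext => n; rewrite big_nil.
rewrite big_cons (_ : (fun n => _) = fun n => u i n + \sum_(j <- r) u j n).
  by apply: cvgD.
by apply/funext => n; rewrite big_cons.
Qed.

(* Tannery's theorem; uniform smallness of the tails replaces domination, which
   the laws of the number of blocks do not satisfy when [gamma <= 1 / 2]. *)
Lemma tannery (R : realType) (q h : nat -> nat -> R) (l : nat -> R) :
  (forall n k, 0 <= q n k) -> (forall n k, 0 <= h n k <= 1) ->
  (forall k, (fun n => q n k * h n k) @ \oo --> l k) ->
  (forall e, 0 < e -> exists M,
     \forall n \near \oo, \sum_(M <= k < n.+1) q n k <= e) ->
  cvgn (series l) /\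
  (fun n => \sum_(k < n.+1) q n k * h n k) @ \oo --> limn (series l).
Proof.
move=> q0 h01 ql tight.
have h0 n k : 0 <= h n k by case/andP: (h01 n k).
have qh0 n k : 0 <= q n k * h n k by rewrite mulr_ge0.
have qhq n k : q n k * h n k <= q n k by rewrite ler_piMr //; case/andP: (h01 n k).
have l0 k : 0 <= l k by apply: (cvgr_to_ge (ql k)); apply: nearW => n.
have snd : nondecreasing_seq (series l).
  by apply: nondecreasing_series => k _ _.
(* For fixed M and N, the segment of the limit series is a limit of segments of the mixtures, hence
   inherits the bound on the tails. *)
have tail e : 0 < e -> exists M, forall N, (M <= N)%N ->
    series l N <= series l M + e /\
    (\forall n \near \oo, \sum_(M <= k < n.+1) q n k <= e).
  move=> e0; have [M HM] := tight e e0; exists M => N MN; split => //.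
  rewrite -lerBlDl sub_series_geq //.
  apply: (cvgr_to_le (cvgn_sum (fun k => ql k))); near=> n.
  have Nn : (N <= n.+1)%N by near: n; exists N => // n /= /leq_trans->.
  apply: (@le_trans _ _ (\sum_(M <= k < n.+1) q n k)); last by near: n.
  rewrite (big_cat_nat MN Nn) /= -[leLHS]addr0 lerD //.
    by apply: ler_sum.
  by apply: sumr_ge0.
have cl : cvgn (series l).
  apply: nondecreasing_is_cvgn => //.
  have [M HM] := tail 1 ltr01; exists (series l M + 1) => _ [N _ <-].
  have [MN|NM] := leqP M N; first by case: (HM N MN).
  by apply: le_trans (snd _ _ (ltnW NM)) _; rewrite lerDl.
split => //; apply/cvgrPdist_le => /= e e0.
(* One third each for the head below M, the tail of the mixture and the tail of the limit series. *)
have e4 : 0 < e / 3 by rewrite divr_gt0.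
have [M HM] := tail _ e4.
have S1 : series l M <= limn (series l) by exact: nondecreasing_cvgn_le.
have S2 : limn (series l) <= series l M + e / 3.
  by apply: limr_le => //; near=> N; have [] := HM N _; first by near: N; exists M.
have /cvgrPdist_le/(_ _ e4) C := @cvgn_sum R nat (index_iota 0 M) (fun k n => q n k * h n k) l ql.
near=> n.
have Mn : (M <= n.+1)%N by near: n; exists M => // n /= /leq_trans->.
rewrite -(big_mkord xpredT (fun k => q n k * h n k)) (big_cat_nat (leq0n M) Mn) /=.
have : `|\sum_(0 <= i < M) l i - \sum_(0 <= i < M) q n i * h n i| <= e / 3 by near: n.
rewrite ler_distl => /andP[C1 C2].
have T1 : 0 <= \sum_(M <= k < n.+1) q n k * h n k by apply: sumr_ge0.
have T2 : \sum_(M <= k < n.+1) q n k * h n k <= e / 3.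
  apply: (@le_trans _ _ (\sum_(M <= k < n.+1) q n k)); first exact: ler_sum.
  by near: n; have [] := HM M (leqnn _).
have sE : series l M = \sum_(0 <= i < M) l i by [].
rewrite sE in S1 S2; move: C1 C2 T1 T2 S1 S2.
set a := \sum_(0 <= i < M) (q _ _ * _); set b := \sum_(M <= i < _) _; set c := \sum_(0 <= i < M) l i.
have : e / 3 + e / 3 + e / 3 = e by field.
move: (limn _) (e / 3) => L d; clearbody a b c => *.
by rewrite ler_distl; apply/andP; split; lra.
Unshelve. all: by end_near. Qed.

Section block_law_limit.
Variables (R : realType) (g z a : R).
Hypotheses (g0 : 0 < g) (adm : admissible g z).
Hypothesis cvB : block_norm g z @ \oo --> a.

Lemma block_norm_lim_gt0 : 0 < a.
Proof.
have : (g^-1 * expR (2 * `|z|))^-1 <= a.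
  apply: (cvgr_to_ge cvB); apply: nearW => n.
  rewrite -[leRHS]invrK lef_pV2 ?posrE ?invr_gt0 ?block_norm_gt0 ?mulr_gt0 ?invr_gt0 ?expR_gt0 //.
  exact: block_norm_inv_le.
by apply: lt_le_trans; rewrite invr_gt0 mulr_gt0 ?invr_gt0 ?expR_gt0.
Qed.

(** The value at 0 is separate because [block_coef g z 0] is 1, whereas a nonempty set has no
    partition into 0 blocks. *)
Definition limit_law k : R := if k is 0%N then 0 else a * block_coef g z k.

Lemma limit_law_ge0 k : 0 <= limit_law k.
Proof.
case: k => // k; rewrite /limit_law mulr_ge0 // ltW ?block_coef_gt0 //.
exact: block_norm_lim_gt0.
Qed.

Lemma limit_law_gt0 k : (0 < k)%N -> 0 < limit_law k.
Proof.
by case: k => // k _; rewrite /limit_law mulr_gt0 ?block_coef_gt0 ?block_norm_lim_gt0.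
Qed.

Lemma cvg_block_law k : (fun n => block_law g z n k) @ \oo --> limit_law k.
Proof.
rewrite -cvg_shiftS /=; case: k => [|k].
  rewrite (_ : (fun n => _) = fun=> 0); first exact: cvg_cst.
  by apply/funext => n; rewrite block_law0.
rewrite (_ : (fun n => _) = fun n => block_coef g z k.+1 * block_norm g z n *
  block_ratio g n.+1 k.+1); last by apply/funext => n; rewrite block_lawE.
rewrite /limit_law [a * _]mulrC -[_ * a]mulr1; apply: cvgM.
  by apply: cvgM => //; exact: cvg_cst.
by rewrite (cvg_shiftS (fun n => block_ratio g n k.+1)); exact: cvg_block_ratio.
Qed.

Lemma cvg_block_mixture (h : nat -> nat -> R) (H : nat -> R) :
  (forall n k, 0 <= h n k <= 1) ->
  (forall k, (0 < k)%N -> (fun n => h n k) @ \oo --> H k) ->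
  cvgn (series (fun k => limit_law k * H k)) /\
  (fun n => \sum_(k < n.+1) block_law g z n k * h n k) @ \oo -->
     limn (series (fun k => limit_law k * H k)).
Proof.
move=> h01 hH; apply: tannery => //.
- by move=> n k; exact: block_law_ge0.
- case=> [|k].
    (* The shift skips [n = 0], the only size at which the law charges [k = 0]. *)
    rewrite /= mul0r -cvg_shiftS (_ : [sequence _]_n = fun=> 0); first exact: cvg_cst.
    by apply/funext => n /=; rewrite block_law0 // mul0r.
  by apply: cvgM; [exact: cvg_block_law|exact: hH].
- by move=> e e0; apply: block_law_tight => //; apply/cvg_ex; exists a.
Qed.
End block_law_limit.

(** * Uniform compositions with bounded parts *)

Lemma compositions_eq0 (r n k : nat) : (k * r < n)%N -> compositions r n k = 0%N.
Proof.
elim: k n => [|k IH] n; first by rewrite mul0n /=; case: n.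
rewrite mulSn => krn /=; rewrite big1 // => j jr; apply: IH; lia.
Qed.

Lemma compositions1 (r n : nat) : (0 < n)%N -> compositions r n 1 = (n <= r)%N.
Proof.
move=> n0; have := @sum_all_compositions r n n 0 (leqnn _).
rewrite eqxx => /(_ isT) /=; rewrite !bin0 !muln1 n0 subn_gt0.
by case: leqP; lia.
Qed.

Lemma cvgn_truncB (R : realType) (u : nat -> nat) (s : R) (m : nat) :
  (fun n => (u n)%:R / n%:R) @ \oo --> s ->
  (fun n => (u n - m)%:R / n%:R) @ \oo --> s.
Proof.
move=> us; apply: (@squeeze_cvgr _ _ _ _
  (fun n => (u n)%:R / n%:R - m%:R * (n%:R + 0)^-1) (fun n => (u n)%:R / n%:R)) => //.
  apply: nearW => n; rewrite addr0 -mulrBl !ler_wpM2r ?invr_ge0 //= ?ler_nat ?leq_subr //.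
  have [mu|um] := leqP m (u n); first by rewrite natrB.
  by rewrite (le_trans _ (ler0n _ _)) // subr_le0 ler_nat ltnW.
have := cvgB us (cvgM (cvg_cst (m%:R : R)) (cvg_natDV (0 : R))).
by rewrite mulr0 subr0; apply.
Qed.

Lemma cvgn_ffact (R : realType) (u : nat -> nat) (s : R) (m : nat) :
  (fun n => (u n)%:R / n%:R) @ \oo --> s ->
  (fun n => (u n ^_ m)%:R / n%:R ^+ m) @ \oo --> s ^+ m.
Proof.
move=> us; elim: m => [|m IH].
  rewrite (_ : (fun n => _) = fun=> 1); first exact: cvg_cst.
  by apply/funext => n; rewrite ffactn0 expr0 divr1.
rewrite (_ : (fun n => _) = fun n => (u n ^_ m)%:R / n%:R ^+ m * ((u n - m)%:R / n%:R)).
  by rewrite exprSr; apply: cvgM => //; exact: cvgn_truncB.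
by apply/funext => n; rewrite ffactnSr natrM exprSr invfM mulrACA.
Qed.

Lemma natrB_max (R : realType) (a b : nat) :
  (a - b)%:R = Num.max 0 (a%:R - b%:R) :> R.
Proof.
have [ba|ab] := leqP b a; first by rewrite natrB // max_r // subr_ge0 ler_nat.
have -> : (a - b = 0)%N by lia.
by rewrite max_l //; rewrite subr_le0 ler_nat ltnW.
Qed.

Lemma cvgn_trunc_residual (R : realType) (r : nat -> nat) (x : R) (i : nat) :
  (fun n => (r n)%:R / n%:R) @ \oo --> x ->
  (fun n => (n - i * r n)%:R / n%:R) @ \oo --> Num.max 0 (1 - i%:R * x).
Proof.
move=> rx.
have maxE (y : R) : Num.max 0 y = (y + `|y|) / 2.
  by case: (leP 0 y) => y0; [rewrite ger0_norm //|rewrite ltr0_norm //]; field.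
have c1 : (fun n => 1 - i%:R * ((r n)%:R / n%:R)) @ \oo --> 1 - i%:R * x.
  by apply: cvgB; [exact: cvg_cst|apply: cvgM => //; exact: cvg_cst].
have c2 : (fun n => (1 - i%:R * ((r n)%:R / n%:R) + `|1 - i%:R * ((r n)%:R / n%:R)|) / 2)
    @ \oo --> (1 - i%:R * x + `|1 - i%:R * x|) / 2.
  by apply: cvgM; [apply: cvgD => //; exact: cvg_norm|exact: cvg_cst].
rewrite maxE; apply: cvg_trans c2; apply: near_eq_cvg; near=> n.
have n0 : 0 < n%:R :> R by rewrite ltr0n; near: n; exists 1%N.
rewrite -maxE natrB_max natrM maxr_pMl ?invr_ge0 ?(ltW n0) // mul0r.
by congr Num.max; field; rewrite gt_eqF.
Unshelve. all: by end_near. Qed.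

(** With [k.+2] parts the count is a falling factorial of degree [k.+1]. One part is left out: its
    count is the indicator of a positive total, whose limit is undetermined when i x = 1. *)
Lemma cvg_all_compositions_ratio (R : realType) (r : nat -> nat) (x : R) (i k : nat) :
  (fun n => (r n)%:R / n%:R) @ \oo --> x ->
  (fun n => (all_compositions (n - i * r n) k.+2)%:R / (all_compositions n k.+2)%:R)
    @ \oo --> Num.max 0 (1 - i%:R * x) ^+ k.+1.
Proof.
move=> rx.
have allE N : (all_compositions N k.+2)%:R = (N.-1 ^_ k.+1)%:R / (k.+1)`!%:R :> R.
  rewrite -bin_ffact natrM mulfK ?pnatr_eq0 -?lt0n ?fact_gt0 //.
  by case: N => [|N]; rewrite [all_compositions _ _]/= ?mul1n.
pose D n : R := (n.-1 ^_ k.+1)%:R / n%:R ^+ k.+1.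
pose U n : R := (((n - i * r n)%N.-1) ^_ k.+1)%:R / n%:R ^+ k.+1.
have nn : (fun n : nat => n%:R / n%:R) @ \oo --> (1 : R).
  apply: cvg_near_cst; near=> n; rewrite divff // pnatr_eq0 -lt0n.
  by near: n; exists 1%N.
have cD : D @ \oo --> (1 : R).
  rewrite -(expr1n R k.+1); apply: cvgn_ffact.
  by under eq_fun do rewrite -subn1; exact: (@cvgn_truncB R id).
have cU : U @ \oo --> Num.max 0 (1 - i%:R * x) ^+ k.+1.
  apply: cvgn_ffact; under eq_fun do rewrite -subn1.
  by apply: (@cvgn_truncB R (fun n => n - i * r n)%N); exact: cvgn_trunc_residual.
have c : (fun n => U n / D n) @ \oo --> Num.max 0 (1 - i%:R * x) ^+ k.+1 / 1.
  by apply: cvgM => //; apply: cvgV => //; exact: oner_neq0.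
rewrite divr1 in c; apply: cvg_trans c; apply: near_eq_cvg; near=> n.
have n0 : n%:R != 0 :> R by rewrite pnatr_eq0 -lt0n; near: n; exists 1%N.
rewrite !allE /U /D !invfM !invrK -!mulrA; congr (_ * _).
have K (b y : R) : y != 0 -> y^-1 * (b * y) = b by move=> y0; rewrite mulrC mulfK.
by rewrite !K ?expf_neq0 // pnatr_eq0 -lt0n fact_gt0.
Unshelve. all: by end_near. Qed.

(* [P (max <= x)] for the uniform law on the simplex with [k] coordinates, by
   inclusion-exclusion; the formula fails for [k = 1], where [0 ^+ 0 = 1]. *)
Definition simplex_max_cdf (R : realType) (k : nat) (x : R) : R :=
  if k is k'.+2 then
    \sum_(i < k.+1) (-1) ^+ i * 'C(k, i)%:R * Num.max 0 (1 - i%:R * x) ^+ k'.+1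
  else (1 <= x)%R%:R.

(** Where there are no compositions the quotient is 0 by convention, and [block_law] vanishes there
    as well. *)
Definition bounded_fraction (R : realType) (r n k : nat) : R :=
  (compositions r n k)%:R / (all_compositions n k)%:R.

Lemma bounded_fraction01 (R : realType) (r n k : nat) :
  0 <= bounded_fraction R r n k <= 1.
Proof.
rewrite /bounded_fraction divr_ge0 //=.
have := leq_compositions r n k; case: (posnP (all_compositions n k)) => [->|c0 le].
  by rewrite leqn0 => /eqP->; rewrite mul0r.
by rewrite ler_pdivrMr ?ltr0n // mul1r ler_nat.
Qed.

(** For one part the fraction is the indicator of n <= r n, which converges only away from the jump
    at x = 1; for more parts the inclusion-exclusion sum converges term by term. *)
Lemma cvg_bounded_fraction (R : realType) (r : nat -> nat) (x : R) (k : nat) :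
  (0 < k)%N -> (k = 1%N -> x != 1) -> (fun n => (r n)%:R / n%:R) @ \oo --> x ->
  (fun n => bounded_fraction R (r n) n k) @ \oo --> simplex_max_cdf k x.
Proof.
case: k => // -[|k] _.
  move=> /(_ erefl) x1 rx; rewrite /simplex_max_cdf /=.
  have [x_lt|x_gt|xE] := ltgtP x 1; last by rewrite xE eqxx in x1.
    apply: cvg_near_cst; near=> n.
    have n0 : (0 < n)%N by near: n; exists 1%N.
    rewrite /bounded_fraction compositions1 //.
    have : (r n)%:R / n%:R < 1 :> R by near: n; apply: cvgr_lt rx _ x_lt.
    rewrite ltr_pdivrMr ?ltr0n // mul1r ltr_nat => /ltn_geF ->.
    by rewrite mul0r.
  apply: cvg_near_cst; near=> n.
  have n0 : (0 < n)%N by near: n; exists 1%N.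
  rewrite /bounded_fraction compositions1 //= bin0 n0.
  have : 1 < (r n)%:R / n%:R :> R by near: n; apply: cvgr_gt rx _ x_gt.
  by rewrite ltr_pdivlMr ?ltr0n // mul1r ltr_nat => /ltnW ->; rewrite divr1.
move=> _ rx; rewrite /simplex_max_cdf /=.
have c : (fun n => \sum_(i < k.+3) (-1) ^+ i * 'C(k.+2, i)%:R *
      ((all_compositions (n - i * r n) k.+2)%:R / (all_compositions n k.+2)%:R)) @ \oo -->
   \sum_(i < k.+3) (-1) ^+ i * 'C(k.+2, i)%:R * Num.max 0 (1 - i%:R * x) ^+ k.+1.
  apply: cvgn_sum => i; apply: cvgM; first exact: cvg_cst.
  exact: cvg_all_compositions_ratio.
apply: cvg_trans c; apply: near_eq_cvg; apply: nearW => n.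
rewrite /bounded_fraction compositions_incl_excl mulr_suml.
by apply: eq_bigr => i _; rewrite -[RHS]mulrA.
Unshelve. all: by end_near. Qed.

(** Realises every x >= 0 by an explicit sequence, so that facts about finite counts pass to
    [simplex_max_cdf]. *)
Lemma cvg_truncn_ratio (R : realType) (x : R) : 0 <= x ->
  (fun n => (Num.truncn (x * n%:R))%:R / n%:R) @ \oo --> x.
Proof.
move=> x0.
apply: (@squeeze_cvgr _ _ _ _ (fun n => x - (n%:R + 0)^-1) (fun n => x)).
- near=> n; have n0 : 0 < n%:R :> R by rewrite ltr0n; near: n; exists 1%N.
  have xn : 0 <= x * n%:R by rewrite mulr_ge0.
  have /andP[r1 r2] := truncn_itv xn.
  rewrite addr0 ler_pdivrMr // r1 andbT ler_pdivlMr // mulrBl mulVf ?gt_eqF //.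
  by rewrite lerBlDr natr1 ltW.
- by have := cvgB (cvg_cst x) (cvg_natDV (0 : R)); rewrite subr0; apply.
- exact: cvg_cst.
Unshelve. all: by end_near. Qed.

(** For k >= 2 the alternating sum is a k-th finite difference of a polynomial of degree k - 1.
    Counting gives 0 at once: [k] parts of size at most [r] cannot reach [n] when k r < n. *)
Lemma simplex_max_cdf_eq0 (R : realType) (k : nat) (x : R) :
  (0 < k)%N -> 0 <= x -> k%:R * x < 1 -> simplex_max_cdf k x = 0.
Proof.
move=> k0 x0 kx1.
have x1 : x < 1 by apply: le_lt_trans kx1; rewrite ler_peMl // ler1n.
have c := cvg_bounded_fraction k0 (fun _ => negbT (lt_eqF x1)) (cvg_truncn_ratio x0).
apply: (cvg_unique _ c) => //; apply: cvg_near_cst; near=> n.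
have n0 : 0 < n%:R :> R by rewrite ltr0n; near: n; exists 1%N.
rewrite /bounded_fraction compositions_eq0 ?mul0r //.
rewrite -(ltr_nat R) natrM; apply: (@le_lt_trans _ _ (k%:R * (x * n%:R))).
  by rewrite ler_wpM2l // truncn_le // mulr_ge0.
by rewrite mulrA -[ltRHS]mul1r ltr_pM2r.
Unshelve. all: by end_near. Qed.

(* The union bound over the blocks exceeding [r]. *)
Lemma compositions_union_bound (r n k : nat) :
  (all_compositions n k <= compositions r n k + k * all_compositions (n - r) k)%N.
Proof.
elim: k n => [|k IH] n; first by rewrite /= addn0.
have := @sum_all_compositions r n n k (leqnn _); rewrite eqxx orbT => /(_ isT) <-.
rewrite mulSnr addnA leq_add2r.
case: (posnP k) => [->|k0]; first by rewrite mul0n addn0.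
apply: (@leq_trans (\sum_(j < n | (j < r)%N)
    (compositions r (n - j.+1) k + k * all_compositions (n - r - j.+1) k))).
  by apply: leq_sum => j _; rewrite subnAC; exact: IH.
rewrite big_split leq_add2l -big_distrr leq_mul2l; apply/orP; right.
by rewrite -(@sum_all_compositions r n (n - r) k) ?leq_subr ?k0 // leq_addr.
Qed.

Lemma simplex_max_cdf_ge (R : realType) (k : nat) (x : R) : 0 <= x ->
  1 - k.+2%:R * Num.max 0 (1 - x) ^+ k.+1 <= simplex_max_cdf k.+2 x.
Proof.
move=> x0; have rx := cvg_truncn_ratio x0.
have k1 : k.+2 = 1%N -> x != 1 by [].
have c1 := cvg_bounded_fraction (isT : (0 < k.+2)%N) k1 rx.
have c2 := @cvg_all_compositions_ratio R _ x 1 k rx.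
rewrite mul1r in c2.
have c3 : (fun n => 1 - k.+2%:R * ((all_compositions (n - 1 * Num.truncn (x * n%:R)) k.+2)%:R /
    (all_compositions n k.+2)%:R)) @ \oo --> 1 - k.+2%:R * Num.max 0 (1 - x) ^+ k.+1.
  by apply: cvgB; [exact: cvg_cst|apply: cvgM => //; exact: cvg_cst].
apply: (ler_cvg_to c3 c1); near=> n.
have nk : (k.+2 <= n)%N by near: n; exists k.+2.
have G0 : 0 < (all_compositions n k.+2)%:R :> R.
  by rewrite ltr0n /= muln_gt0 bin_gt0; lia.
rewrite mul1n lerBlDr -(ler_pM2r G0) mulrDl mul1r /bounded_fraction -mulrA mulVf ?gt_eqF //.
rewrite mulr1 -[X in _ <= _ + X]mulrA divfK ?gt_eqF // -natrM -natrD ler_nat.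
exact: compositions_union_bound.
Unshelve. all: by end_near. Qed.

(** Supplies the positive term that makes the limit of P(L <= r) nonzero. *)
Lemma simplex_max_cdf_ex_gt0 (R : realType) (x : R) : 0 < x ->
  exists k, 0 < simplex_max_cdf k.+2 x.
Proof.
(* With M = m + 1 > 2 / x^2 one has exp(M x) >= 1 + (M x)^2 / 2 > 1 + M, so the union bound (M + 1)
   exp(-x)^M is below 1. *)
move=> x0; pose m := Num.truncn (2 / x ^+ 2) .
exists m; apply: lt_le_trans (simplex_max_cdf_ge m (ltW x0)); rewrite subr_gt0.
have d0 : 0 <= 2 / x ^+ 2 by rewrite divr_ge0 ?sqr_ge0.
have /andP[_ tm] := truncn_itv d0; rewrite -/m in tm.
have mx : Num.max 0 (1 - x) <= expR (- x).
  by rewrite ge_max expR_ge0 /=; exact: expR_ge1Dx.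
apply: (@le_lt_trans _ _ (m.+2%:R * expR (- x) ^+ m.+1)).
  by rewrite ler_wpM2l // lerXn2r ?nnegrE ?expR_ge0 // le_max lexx.
rewrite -expRM_natl mulrN expRN ltr_pdivrMr ?expR_gt0 // mul1r.
have M0 : 0 < m.+1%:R :> R by [].
set M : R := m.+1%:R in tm M0 *.
have -> : m.+2%:R = 1 + M :> R by rewrite nat1r.
have xM : 0 <= M * x by rewrite mulr_ge0 // ltW.
apply: lt_le_trans (expR_ge1Dxn 1 xM).
have H : 2 < M * x ^+ 2 by rewrite -ltr_pdivrMr ?exprn_gt0.
rewrite ltrD2l (_ : (M * x) ^+ 2 / 2`!%:R = M * (M * x ^+ 2 / 2)); last first.
  by rewrite exprMn expr2 -!mulrA.
by rewrite ltr_pMr // ltr_pdivlMr // mul1r.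
Qed.

(** * Incomplete Dirichlet integrals *)

Section dirichlet.
Variable R : realType.
Local Notation mu := (@lebesgue_measure R).

Lemma integral_power (p B : R) (m : nat) (c : R) : p < B ->
  (\int[mu]_(y in `]p, B[) (c * (B - y) ^+ m)%:E)%E =
  (c * (B - p) ^+ m.+1 / m.+1%:R)%:E.
Proof.
move=> pB.
pose F (y : R) : R := - (c / m.+1%:R) * (B - y) ^+ m.+1.
have dF (y : R) : is_derive y (1 : R) F (c * (B - y) ^+ m).
  pose P : {poly R} := (- (c / m.+1%:R)) *: (B%:P - 'X) ^+ m.+1.
  have -> : F = fun y => P.[y] by apply/funext => t; rewrite /F /P !hornerE.
  apply: is_derive_eq.
  rewrite /P derivZ deriv_exp derivB derivC derivX !hornerE /=.
  rewrite hornerMn !hornerE -mulr_natr; field.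
  by rewrite nat1r pnatr_eq0.
have cF : continuous F.
  by move=> y; apply/differentiable_continuous/derivable1_diffP; case: (dF y).
have cf : continuous (fun y : R => c * (B - y) ^+ m).
  rewrite (_ : (fun y => _) = fun y => (c *: (B%:P - 'X) ^+ m).[y]).
    exact: continuous_horner.
  by apply/funext => y; rewrite !hornerE.
rewrite -(@integral_itv_bndoo _ p B _ true false); last first.
  apply/measurable_EFinP; apply: measurable_funTS.
  exact: continuous_measurable_fun.
rewrite (@continuous_FTC2 _ _ F) //.
- rewrite /F subrr expr0n /= mulr0 -EFinB sub0r; congr EFin; field.
  by rewrite nat1r pnatr_eq0.
- exact: continuous_subspaceT.
- split.
  + by move=> y _; case: (dF y).
  + by apply: cvg_at_right_filter; exact: cF.
  + by apply: cvg_at_left_filter; exact: cF.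
- by move=> y _; rewrite derive1E; case: (dF y).
Qed.

(** The total [s] is a parameter because fixing the first coordinate at [y] leaves the same
    integrand with total [s - y]. *)
Definition simplex_integrand (p : R) (e : nat) (s : R) (ys : seq R) : \bar R :=
  if all (fun t => p < t) ys && (\sum_(t <- ys) t < s)
  then ((s - \sum_(t <- ys) t) ^+ e)%:E else 0%E.

Lemma iter_integral0 (b : nat) : iter_integral b (fun=> 0%E) = 0%E :> \bar R.
Proof.
elim: b => // b IH /=.
under eq_integral => y _ do rewrite IH.
exact: integral0.
Qed.

(** Translating every coordinate by [p] turns this into the Dirichlet integral over a simplex of
    size s - b p. *)
Lemma iter_integral_simplex (p : R) (e b : nat) (s : R) :
  iter_integral b (simplex_integrand p e s) =
  (if b%:R * p < s
   then (e`!%:R / (e + b)`!%:R) * (s - b%:R * p) ^+ (e + b) else 0)%:E.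
Proof.
have f0 m : (m`!)%:R != 0 :> R by rewrite pnatr_eq0 -lt0n fact_gt0.
elim: b s => [|b IH] s.
  rewrite /= /simplex_integrand /= big_nil mul0r addn0 subr0.
  by case: ifP => // _; rewrite divff // mul1r.
pose K : R := e`!%:R / (e + b)`!%:R.
transitivity (\int[mu]_(y in `]p, (s - b%:R * p)%R[)
    (K * ((s - b%:R * p) - y) ^+ (e + b))%:E)%E.
  rewrite [RHS]integral_mkcond; apply: eq_integral => y _.
  have E ys : simplex_integrand p e s (y :: ys) =
     if p < y then simplex_integrand p e (s - y) ys else 0%E.
    rewrite /simplex_integrand /= big_cons; case: (p < y) => //=.
    by rewrite ltrBrDl opprD addrA.
  rewrite (_ : (fun ys => _) = fun ys =>
     if p < y then simplex_integrand p e (s - y) ys else 0%E); last exact/funext.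
  rewrite patchE mem_setE in_itv /=; case: (p < y) => /=; last exact: iter_integral0.
  transitivity (iter_integral b (simplex_integrand p e (s - y))); first by [].
  rewrite IH [_ < s - y]ltrBrDr [y < _]ltrBrDl; case: ifP => // _.
  by congr (_ * _ ^+ _)%:E; ring.
case: ifP => sp.
  rewrite integral_power; last by move: sp; rewrite -natr1 mulrDl mul1r -ltrBrDl.
  rewrite addnS factS natrM /K; congr EFin.
  have -> : s - b%:R * p - p = s - b.+1%:R * p by rewrite -natr1; ring.
  by field; rewrite f0 -natrD nat1r pnatr_eq0.
rewrite set_itv_ge ?integral_set0 // bnd_simp -leNgt lerBlDr addrC.
by rewrite -[X in _ <= _ + X]mul1r -mulrDl natr1 leNgt sp.
Qed.
End dirichlet.

(** * The Gamma function *)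

Section elementary_bounds.
Variable R : realType.
Implicit Types t v : R.

Lemma ler_norm_sqr t v : `|t| <= `|v| -> t ^+ 2 <= v ^+ 2.
Proof.
move=> tv; rewrite -(real_normK (num_real t)) -(real_normK (num_real v)).
by rewrite lerXn2r ?nnegrE.
Qed.

Lemma expR_dist1_le t : 2 * `|t| <= 1 -> `|expR t - 1 - t| <= 2 * t ^+ 2.
Proof.
move=> t12; have t1 : - t <= `|t| by rewrite -normrN ler_norm.
have t2 := ler_norm t; have t3 : 0 < 1 - t by lra.
have e1 : 1 + t <= expR t by exact: expR_ge1Dx.
have e2 : expR t <= (1 - t)^-1.
  rewrite -[expR t]invrK -expRN lef_pV2 ?posrE ?expR_gt0 //.
  exact: expR_ge1Dx.
have e3 : (1 - t)^-1 <= 1 + t + 2 * t ^+ 2.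
  rewrite -[leLHS]mul1r ler_pdivrMr //.
  have -> : (1 + t + 2 * t ^+ 2) * (1 - t) = 1 + t ^+ 2 * (1 - 2 * t) by ring.
  by rewrite lerDl mulr_ge0 ?sqr_ge0 //; lra.
have t0 := sqr_ge0 t.
by rewrite ler_norml; apply/andP; split; lra.
Qed.

(** Source of both the first-order and the second-order bound on the sine, the latter through cos c
    - 1. *)
Lemma sin_mean_value v : exists2 c, `|c| <= `|v| & sin v = cos c * v.
Proof.
wlog v0 : v / 0 <= v.
  move=> H; have [v0|v0] := leP 0 v; first exact: H.
  have [|c cv cE] := H (- v); first by lra.
  exists c; first by rewrite -(normrN v).
  by apply: oppr_inj; rewrite -sinN cE mulrN.
have [|c] := @MVT_segment R sin cos 0 v v0 (fun y _ => is_derive_sin y).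
  by apply: continuous_subspaceT => y; exact: continuous_sin.
rewrite in_itv /= => /andP[c0 cv]; rewrite sin0 !subr0 => ->.
by exists c => //; rewrite !ger0_norm.
Qed.

Lemma ler_norm_sin v : `|sin v| <= `|v|.
Proof.
have [c _ ->] := sin_mean_value v; rewrite normrM ler_piMl //.
by rewrite ler_norml cos_geN1 cos_le1.
Qed.

Lemma cos_dist1_le v : `|cos v - 1| <= v ^+ 2 / 2.
Proof.
have E : cos v - 1 = - (2 * sin (v / 2) ^+ 2).
  have vE : v = (v / 2) *+ 2 by rewrite -mulr_natr; field.
  by rewrite {1}vE cos_mulr2n cos2sin2 -mulr_natr; ring.
rewrite E normrN ger0_norm; last by rewrite mulr_ge0 ?sqr_ge0.
have -> : v ^+ 2 / 2 = 2 * (v / 2) ^+ 2 by field.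
by rewrite ler_pM2l //; apply: ler_norm_sqr; exact: ler_norm_sin.
Qed.

Lemma sin_dist_le v : `|v| <= 1 -> `|sin v - v| <= v ^+ 2.
Proof.
move=> v1; have [c cv ->] := sin_mean_value v.
have -> : cos c * v - v = (cos c - 1) * v by ring.
have c2 : c ^+ 2 <= v ^+ 2 by exact: ler_norm_sqr.
rewrite normrM; apply: (@le_trans _ _ (c ^+ 2 / 2 * 1)).
  by rewrite ler_pM // cos_dist1_le.
have := sqr_ge0 c; lra.
Qed.

Lemma lnS_itv (n : nat) : (0 < n)%N ->
  n.+1%:R^-1 <= ln (n.+1%:R : R) - ln n%:R <= n%:R^-1.
Proof.
move=> n0; have N0 : 0 < n%:R :> R by rewrite ltr0n.
have N1 : 0 < n.+1%:R :> R by rewrite ltr0n.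
rewrite -ln_div ?posrE //; apply/andP; split.
  rewrite -[X in _ <= ln X]invrK lnV ?posrE ?invr_gt0 ?divr_gt0 // lerNr.
  have -> : (n.+1%:R / n%:R)^-1 = 1 + - n.+1%:R^-1 :> R.
    by rewrite -natr1; field; rewrite natr1 !gt_eqF.
  by apply: le_ln1Dx; rewrite ltrN2 invf_lt1 // ltr1n ltnS.
have -> : n.+1%:R / n%:R = 1 + n%:R^-1 :> R by rewrite -natr1; field; rewrite gt_eqF.
by apply: le_ln1Dx; rewrite (lt_trans _ (_ : 0 < n%:R^-1)) ?invr_gt0 // ltrN10.
Qed.
End elementary_bounds.

(** * Convergence of complex sequences *)

Section complex_sequences.
Variable R : realType.
Local Notation Re := (@complex.Re R).
Local Notation Im := (@complex.Im R).
Local Notation normc := ComplexField.Normc.normc.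

Lemma normc_le (z : R[i]) : normc z <= `|Re z| + `|Im z|.
Proof.
case: z => x y /=; rewrite -[leRHS]ger0_norm ?addr_ge0 // -sqrtr_sqr ler_wsqrtr //.
rewrite sqrrD !real_normK ?num_real // -addrA lerD2l addrC lerDl.
by rewrite mulrn_wge0 // mulr_ge0.
Qed.

Lemma Re_le_normc (z : R[i]) : `|Re z| <= normc z.
Proof. by case: z => x y /=; rewrite -sqrtr_sqr ler_wsqrtr // lerDl sqr_ge0. Qed.

Lemma Im_le_normc (z : R[i]) : `|Im z| <= normc z.
Proof. by case: z => x y /=; rewrite -sqrtr_sqr ler_wsqrtr // lerDr sqr_ge0. Qed.

Lemma cvg_complex (u : nat -> R[i]^o) (w : R[i]) :
  Re \o u @ \oo --> Re w -> Im \o u @ \oo --> Im w -> u @ \oo --> (w : R[i]^o).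
Proof.
move=> cr ci; apply/cvgrPdist_lt => -[e e'] /[!ltcE] /= /andP[/eqP -> e0].
have e2 : 0 < e / 2 by rewrite divr_gt0.
move/cvgrPdist_lt/(_ _ e2) in cr; move/cvgrPdist_lt/(_ _ e2) in ci.
near=> n.
have H1 : `|Re w - Re (u n)| < e / 2 by near: n.
have H2 : `|Im w - Im (u n)| < e / 2 by near: n.
have H : normc (w - u n) < e.
  apply: le_lt_trans (normc_le _) _; rewrite !raddfB /=.
  have -> : e = e / 2 + e / 2 by field.
  exact: ltrD.
by rewrite -[`|_|]/((normc (w - u n))%:C) ltcE /= eqxx.
Unshelve. all: by end_near. Qed.

Lemma cvg_Re (u : nat -> R[i]^o) (w : R[i]) :
  u @ \oo --> (w : R[i]^o) -> (fun n => Re (u n)) @ \oo --> Re w.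
Proof.
move=> uw; apply/cvgrPdist_lt => e e0.
have eC0 : 0 < e%:C :> R[i] by rewrite ltcE /= eqxx.
move/cvgrPdist_lt/(_ _ eC0) : uw; apply: filterS => n.
rewrite -[`|w - u n|]/((normc (w - u n))%:C) ltcE /= eqxx /= -raddfB.
exact: le_lt_trans (Re_le_normc _).
Qed.

Lemma cvg_real_complex (u : nat -> R) (l : R) :
  u @ \oo --> l -> (fun n => (u n)%:C : R[i]^o) @ \oo --> (l%:C : R[i]^o).
Proof. by move=> ul; apply: cvg_complex => //=; exact: cvg_cst. Qed.

Lemma complex_cvg_lim (u : nat -> R[i]^o) (w : R[i]^o) :
  u @ \oo --> w -> limn u = w.
Proof. by apply: cvg_lim; exact: norm_hausdorff. Qed.

Lemma subr_div_succ (D : R) (k : nat) : (0 < k)%N ->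
  D / k%:R - D / k.+1%:R = D / (k%:R * k.+1%:R).
Proof.
by rewrite lt0n => k0; field; rewrite nat1r !pnatr_eq0 k0.
Qed.

(** The bound telescopes, so beyond [N] the sequence f + D / n is nonincreasing and f - D / n is
    nondecreasing; monotone convergence applies to the former. *)
Lemma cvg_increments (f : nat -> R) (D : R) (N : nat) : (0 < N)%N ->
  (forall n, (N <= n)%N -> `|f n.+1 - f n| <= D / (n%:R * n.+1%:R)) ->
  cvgn f.
Proof.
move=> N0 fD.
pose h n := f (n + N)%N + D / (n + N)%:R.
have M0 n : (0 < n + N)%N by lia.
have hE n := subr_div_succ D (M0 n).
have D0 : 0 <= D.
  have := le_trans (normr_ge0 _) (fD N (leqnn N)).
  by rewrite pmulr_lge0 // invr_gt0 mulr_gt0 // ltr0n.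
have lo n : f N - D / N%:R <= f (n + N)%N - D / (n + N)%:R.
  elim: n => [|n]; first by rewrite add0n.
  move/le_trans; apply; have := fD (n + N)%N (leq_addl _ _).
  rewrite ler_norml -hE addSn.
  move: (D / _) (D / _) (f _) (f _) => x y u v /andP[H _]; lra.
have ch : cvgn h.
  apply: nonincreasing_is_cvgn.
    apply/nonincreasing_seqP => n; rewrite /h addSn.
    have := fD (n + N)%N (leq_addl _ _).
    rewrite ler_norml -hE.
    by move: (D / _) (D / _) (f _) (f _) => x y u v /andP[_ H]; lra.
  exists (f N - D / N%:R) => _ [n _ <-]; apply: le_trans (lo n) _.
  by rewrite /h lerD2l ge0_cp // divr_ge0.
have c : (fun n => f (n + N)%N) @ \oo --> limn h.
  have -> : (fun n => f (n + N)%N) = (fun n => h n - D * (n%:R + N%:R)^-1).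
    by apply/funext => n; rewrite /h natrD addrK.
  have := cvgB ch (cvgM (cvg_cst (D : R)) (cvg_natDV (N%:R : R))).
  by rewrite mulr0 subr0; apply.
by apply/cvg_ex; exists (limn h); rewrite -(cvg_shiftn N).
Qed.

(** Convergence of an infinite product without logarithms: the factors 1 + C / (n (n + 1)) are at
    most the exponentials of a telescoping sum. This bounds the sequence, and then its absolute
    increments. *)
Lemma cvg_relative_increments (a : nat -> R[i]^o) (C : R) (N : nat) :
  (0 < N)%N -> 0 <= C ->
  (forall n, (N <= n)%N ->
     normc (a n.+1 - a n) <= C / (n%:R * n.+1%:R) * normc (a n)) ->
  cvgn a.
Proof.
move=> N0 C0 aC.
pose M := normc (a N) * expR (C / N%:R).
have n0 (z : R[i]) : 0 <= normc z by exact: le_trans (Re_le_normc z).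
have bnd n : (N <= n)%N -> normc (a n) <= M.
  move=> /subnK <-; move: (n - N)%N => {}n.
  suff : normc (a (n + N)%N) <= normc (a N) * expR (C / N%:R - C / (n + N)%:R).
    move/le_trans; apply; rewrite ler_wpM2l // ler_expR gerBl divr_ge0 //.
  elim: n => [|n IH]; first by rewrite add0n subrr expR0 mulr1.
  have H := aC (n + N)%N (leq_addl _ _).
  have : normc (a (n + N).+1) <= normc (a (n + N)%N) * (1 + C / ((n + N)%:R * (n + N).+1%:R)).
    rewrite mulrDr mulr1 [X in _ <= _ + X]mulrC.
    apply: (le_trans _ (lerD (lexx _) H)).
    have := @le_normcD R (a (n + N)%N) (a (n + N).+1 - a (n + N)%N).
    by rewrite addrC subrK.
  move/le_trans; apply.
  apply: (@le_trans _ _ (normc (a N) * expR (C / N%:R - C / (n + N)%:R) *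
     expR (C / ((n + N)%:R * (n + N).+1%:R)))).
    rewrite ler_pM // ?expR_ge1Dx // addr_ge0 // divr_ge0 // mulr_ge0 //.
  rewrite -mulrA -expRD addSn ler_wpM2l // ler_expR.
  rewrite -subr_div_succ; last by lia.
  by rewrite addrA subrK.
have incr n : (N <= n)%N -> normc (a n.+1 - a n) <= C * M / (n%:R * n.+1%:R).
  move=> Nn; apply: le_trans (aC n Nn) _.
  by rewrite mulrAC ler_wpM2r ?invr_ge0 ?mulr_ge0 // ler_wpM2l // bnd.
have cr : cvgn (fun n => Re (a n)).
  apply: (cvg_increments N0 (D := C * M)) => n Nn; rewrite -raddfB.
  exact: le_trans (Re_le_normc _) (incr n Nn).
have ci : cvgn (fun n => Im (a n)).
  apply: (cvg_increments N0 (D := C * M)) => n Nn; rewrite -raddfB.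
  exact: le_trans (Im_le_normc _) (incr n Nn).
apply/cvg_ex; exists (limn (fun n => Re (a n)) +i* limn (fun n => Im (a n)) : R[i]^o).
exact: cvg_complex.
Qed.
End complex_sequences.

(** * Euler's limit formula *)

Section gamma_function.
Variable R : realType.
Local Notation Re := (@complex.Re R).
Local Notation Im := (@complex.Im R).
Local Notation normc := ComplexField.Normc.normc.
Implicit Types z : R[i].

Definition gamma_seq (z : R[i]) (n : nat) : R[i] :=
  n`!%:R * natcpow n z / rfact z n.+1.

(** This is exp(z L) for complex [z] and real [L]. *)
Definition cis_exp (z : R[i]) (L : R) : R[i] :=
  (expR (Re z * L) * cos (Im z * L)) +i* (expR (Re z * L) * sin (Im z * L)).

Lemma normc_real (x : R) : normc x%:C = `|x|.
Proof. by rewrite /= expr0n addr0 sqrtr_sqr. Qed.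

Lemma normc_ge0 z : 0 <= normc z.
Proof. exact: le_trans (Re_le_normc z). Qed.

Lemma normc_triangle z w : normc (z + w) <= normc z + normc w.
Proof. exact: (@le_normcD R z w). Qed.

Lemma natr_complex (n : nat) : n%:R = (n%:R : R)%:C :> R[i].
Proof. by rewrite rmorph_nat. Qed.

Lemma natcpowE (n : nat) z : (0 < n)%N -> natcpow n z = cis_exp z (ln n%:R).
Proof.
move=> n0; rewrite /natcpow /cis_exp /powR pnatr_eq0 gtn_eqF //.
by apply/eqP; rewrite eq_complex /= !mul0r subr0 addr0 !eqxx.
Qed.

Lemma cis_expD z (L1 L2 : R) : cis_exp z (L1 + L2) = cis_exp z L1 * cis_exp z L2.
Proof.
rewrite /cis_exp !mulrDr expRD cosD sinD.
by apply/eqP; rewrite eq_complex /=; apply/andP; split; apply/eqP; ring.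
Qed.

Lemma cis_exp_add z w (L : R) : cis_exp (z + w) L = cis_exp z L * cis_exp w L.
Proof.
rewrite /cis_exp !raddfD /= !mulrDl expRD cosD sinD.
by apply/eqP; rewrite eq_complex /=; apply/andP; split; apply/eqP; ring.
Qed.

(** Second-order Taylor bound; the real and the imaginary part each contribute 2 + 1 to the constant
    6. *)
Lemma cis_exp_dist z (L : R) : 0 <= L -> 2 * (normc z * L) <= 1 ->
  normc (cis_exp z L - 1 - z * L%:C) <= 6 * (normc z * L) ^+ 2.
Proof.
move=> L0; set d := normc z * L => d1.
have d0 : 0 <= d by rewrite mulr_ge0 ?normc_ge0.
have td : `|Re z * L| <= d by rewrite normrM (ger0_norm L0) ler_wpM2r ?Re_le_normc.
have vd : `|Im z * L| <= d by rewrite normrM (ger0_norm L0) ler_wpM2r ?Im_le_normc.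
have sq (x : R) : `|x| <= d -> x ^+ 2 <= d ^+ 2.
  by move=> xd; apply: ler_norm_sqr; rewrite (ger0_norm d0).
apply: le_trans (normc_le _) _.
have -> : Re (cis_exp z L - 1 - z * L%:C) =
    expR (Re z * L) * cos (Im z * L) - 1 - Re z * L.
  by case: z {d d0 d1 td vd sq} => x y /=; rewrite mulr0 subr0.
have -> : Im (cis_exp z L - 1 - z * L%:C) =
    expR (Re z * L) * sin (Im z * L) - Im z * L.
  by case: z {d d0 d1 td vd sq} => x y /=; rewrite mulr0 add0r subr0.
move: (Re z * L) (Im z * L) td vd => t v td vd.
have t1 : 2 * `|t| <= 1 by lra.
have e1 := expR_dist1_le t1.
have t2 := sq _ td; have v2 := sq _ vd.
have e2 : `|expR t - 1| <= 2 * d.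
  have -> : expR t - 1 = (expR t - 1 - t) + t by ring.
  apply: le_trans (ler_normD _ _) _.
  have : 2 * d ^+ 2 <= d by rewrite expr2 mulrA ler_piMl.
  lra.
have e3 : expR t <= 2.
  have := ler_norm (expR t - 1); lra.
have c1 := cos_dist1_le v.
have s1 := ler_norm_sin v.
have s2 : `|sin v - v| <= v ^+ 2 by apply: sin_dist_le; lra.
have -> : expR t * cos v - 1 - t = (expR t - 1 - t) + expR t * (cos v - 1) by ring.
have -> : expR t * sin v - v = (expR t - 1) * sin v + (sin v - v) by ring.
have r1 : `|expR t * (cos v - 1)| <= d ^+ 2.
  rewrite normrM (ger0_norm (expR_ge0 t)).
  apply: (@le_trans _ _ (2 * (v ^+ 2 / 2))); first by rewrite ler_pM ?expR_ge0.
  by rewrite mulrC divfK.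
have r2 : `|(expR t - 1) * sin v| <= 2 * d ^+ 2.
  rewrite normrM expr2 mulrA ler_pM //; exact: le_trans s1 vd.
apply: (@le_trans _ _ (`|expR t - 1 - t| + `|expR t * (cos v - 1)| +
   (`|(expR t - 1) * sin v| + `|sin v - v|))); first by rewrite lerD ?ler_normD.
move: e1 r1 r2 s2; move: `|expR t - 1 - t| `|expR t * _| `|_ * sin v| `|sin v - v| => a b c e.
move: t2 v2; move: (d ^+ 2) (t ^+ 2) (v ^+ 2) => D T V *; lra.
Qed.

Lemma rfact_neq0 z n : ~ Gamma_pole z -> rfact z n != 0.
Proof.
move=> zp; rewrite prodf_seq_neq0; apply/allP => j _ /=.
by apply/negP; rewrite addr_eq0 => /eqP zE; apply: zp; exists (val j).
Qed.

Lemma rfactSC z n : rfact z n.+1 = rfact z n * (z + n%:R).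
Proof. by rewrite /rfact big_ord_recr. Qed.

(** The denominator z + n + 1 provides the subtracted z / (n + 1), which cancels the first-order
    term of the exponential. *)
Lemma gamma_seqS z n : ~ Gamma_pole z -> (0 < n)%N ->
  gamma_seq z n.+1 - gamma_seq z n = gamma_seq z n *
    (n.+1%:R / (z + n.+1%:R) * (cis_exp z (ln n.+1%:R - ln n%:R) - 1 - z / n.+1%:R)).
Proof.
move=> zp n0.
have z0 : z + n.+1%:R != 0.
  by apply/negP; rewrite addr_eq0 => /eqP zE; apply: zp; exists n.+1.
rewrite /gamma_seq (rfactSC z n.+1) factS natrM !natcpowE //.
have -> : ln n.+1%:R = ln n%:R + (ln n.+1%:R - ln n%:R) :> R by rewrite addrC subrK.
rewrite cis_expD [_ + (_ - _)]addrC subrK.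
have r0 := rfact_neq0 n.+1 zp.
move: (cis_exp z _) (cis_exp z _) => P Q.
have N0 : n.+1%:R != 0 :> R[i] by rewrite pnatr_eq0.
move: (n.+1%:R) N0 z0 => N N0 z0.
by field; rewrite N0 z0 r0.
Qed.

Lemma cvg_gamma_seq z : ~ Gamma_pole z ->
  (gamma_seq z : nat -> R[i]^o) @ \oo --> (Gamma z : R[i]^o).
Proof.
(* Write N = n + 1 and L = ln N - ln n. Once n >= 2|z|, the factor N / (z + N) has modulus at most
   2. The Taylor error 6 (|z| L)^2 is at most 12 |z|^2 / (n N), and replacing L by 1 / N costs at
   most |z| / (n N). *)
move=> zp; apply: (@cvg_relative_increments R _ (2 * (12 * normc z ^+ 2 + normc z))
  (Num.truncn (2 * normc z)).+1) => //.
  by rewrite mulr_ge0 // addr_ge0 ?mulr_ge0 ?sqr_ge0 ?normc_ge0.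
move=> n nz.
have n0 : (0 < n)%N by exact: leq_trans nz.
have zn : 2 * normc z <= n%:R.
  have /andP[_ /ltW h] := truncn_itv (mulr_ge0 (ler0n R 2) (normc_ge0 z)).
  by apply: le_trans h _; rewrite ler_nat.
rewrite gamma_seqS // ComplexField.Normc.normcM mulrC ler_wpM2r ?normc_ge0 //.
rewrite ComplexField.Normc.normcM.
have N0 : 0 < n%:R :> R by rewrite ltr0n.
have N1 : 0 < n.+1%:R :> R by rewrite ltr0n.
set c := normc z in zn *.
have c0 : 0 <= c by exact: normc_ge0.
have b1 : normc (n.+1%:R / (z + n.+1%:R)) <= 2.
  rewrite ComplexField.Normc.normcM ComplexField.Normc.normcV natr_complex normc_real.
  rewrite ger0_norm ?(ltW N1) //.
  have h : n.+1%:R <= c + normc (z + (n.+1%:R : R)%:C).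
    have := normc_triangle (- z) (z + (n.+1%:R : R)%:C).
    rewrite addrA addNr add0r normc_real (ger0_norm (ltW N1)).
    by rewrite (@normcN R z).
  have h2 : n.+1%:R = n%:R + 1 :> R by rewrite natr1.
  rewrite ler_pdivrMr; last by move: h h2 zn; move: (normc (z + _)) => w; lra.
  by move: h h2 zn; move: (normc (z + _)) => w; lra.
have /andP[L1 L2] := @lnS_itv R n n0.
set L := ln n.+1%:R - ln n%:R in L1 L2 *.
have L0 : 0 <= L by apply: le_trans L1; rewrite invr_ge0.
have cL : 2 * (c * L) <= 1.
  apply: (@le_trans _ _ (2 * (c * n%:R^-1))); first by rewrite ler_pM2l // ler_wpM2l.
  by rewrite mulrA ler_pdivrMr // mul1r.
have b2 : normc (cis_exp z L - 1 - z / n.+1%:R) <=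
    (12 * c ^+ 2 + c) / (n%:R * n.+1%:R).
  have -> : cis_exp z L - 1 - z / n.+1%:R =
     (cis_exp z L - 1 - z * L%:C) + z * (L - n.+1%:R^-1)%:C.
    have -> (l : R) : (l - n.+1%:R^-1)%:C = l%:C - n.+1%:R^-1 :> R[i].
      by rewrite rmorphB -(rmorph_nat (real_complex R) n.+1) -fmorphV.
    ring.
  apply: le_trans (normc_triangle _ _) _.
  rewrite ComplexField.Normc.normcM normc_real -/c mulrDl.
  apply: lerD.
    apply: le_trans (cis_exp_dist L0 cL) _; rewrite -/c exprMn.
    have -> : 12 * c ^+ 2 / (n%:R * n.+1%:R) = 6 * (c ^+ 2 * (2 / (n%:R * n.+1%:R))) by ring.
    rewrite ler_pM2l // ler_wpM2l ?sqr_ge0 //.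
    apply: (@le_trans _ _ (n%:R^-1 ^+ 2)); first by rewrite lerXn2r // nnegrE // invr_ge0.
    rewrite ler_pdivlMr ?mulr_gt0 //.
    have -> : n%:R^-1 ^+ 2 * (n%:R * n.+1%:R) = n.+1%:R / n%:R :> R.
      by field; rewrite gt_eqF.
    rewrite ler_pdivrMr // -natrM ler_nat; lia.
  rewrite ler_wpM2l // ger0_norm ?subr_ge0 //.
  by rewrite -[leRHS]mul1r -subr_div_succ // !mul1r lerD2r.
apply: le_trans (ler_pM (normc_ge0 _) (normc_ge0 _) b1 b2) _.
by rewrite mulrA.
Qed.

Definition real_gamma_seq (g : R) (n : nat) : R :=
  n`!%:R * n%:R `^ g / rfact g n.+1.

Lemma gamma_seq_real (g : R) (n : nat) : (0 < n)%N ->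
  gamma_seq g%:C n = (real_gamma_seq g n)%:C.
Proof.
move=> n0; rewrite /gamma_seq /real_gamma_seq rmorphM fmorphV rmorphM rmorph_nat.
congr (_ * _ / _).
  by rewrite /natcpow /= mul0r cos0 sin0 mulr1.
by rewrite /rfact rmorph_prod; apply: eq_bigr => i _; rewrite rmorphD rmorph_nat.
Qed.

Lemma real_pole_neq (g : R) : 0 < g -> ~ Gamma_pole g%:C.
Proof.
move=> g0 [k /(congr1 (fun w => Re w))]; rewrite natr_complex -rmorphN /= => gE.
by move: g0; rewrite gE oppr_gt0 ltrn0.
Qed.

Lemma cvg_real_gamma_seq (g : R) : 0 < g ->
  real_gamma_seq g @ \oo --> realGamma g.
Proof.
move=> g0; have c := cvg_Re (cvg_gamma_seq (real_pole_neq g0)).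
apply: cvg_trans c; apply: near_eq_cvg; near=> n.
by rewrite gamma_seq_real //; near: n; exists 1%N.
Unshelve. all: by end_near. Qed.

Lemma Gamma_real (g : R) : 0 < g -> Gamma g%:C = (realGamma g)%:C.
Proof.
move=> g0; have c := cvg_real_complex (cvg_real_gamma_seq g0).
apply: complex_cvg_lim; apply: cvg_trans c; apply: near_eq_cvg; near=> n.
by rewrite -[LHS]gamma_seq_real //; near: n; exists 1%N.
Unshelve. all: by end_near. Qed.

Lemma real_gamma_seq_gt0 (g : R) (n : nat) : 0 < g -> (0 < n)%N -> 0 < real_gamma_seq g n.
Proof.
move=> g0 n0; rewrite /real_gamma_seq divr_gt0 ?rfact_gt0 // mulr_gt0 ?powR_gt0 ?ltr0n //.
exact: fact_gt0.
Qed.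

(** Positive terms alone could tend to 0. Euler's sequence moreover increases from index 1, because
    exp(g (ln N - ln (N - 1))) >= exp(g / N) >= 1 + g / N. *)
Lemma realGamma_gt0 (g : R) : 0 < g -> 0 < realGamma g.
Proof.
move=> g0; apply: lt_le_trans (real_gamma_seq_gt0 g0 (isT : (0 < 1)%N)) _.
apply: (cvgr_to_ge (cvg_real_gamma_seq g0)); exists 1%N => // n /=.
elim: n => // n IH _; case: (posnP n) => [->//|n0]; apply: le_trans (IH n0) _.
have N0 : 0 < n%:R :> R by rewrite ltr0n.
have N1 : 0 < n.+1%:R :> R by rewrite ltr0n.
have r0 := rfact_gt0 n.+1 g0.
have -> : real_gamma_seq g n.+1 = real_gamma_seq g n *
    (expR (g * (ln n.+1%:R - ln n%:R)) / (1 + g / n.+1%:R)).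
  rewrite /real_gamma_seq (rfactS g n.+1) factS natrM /powR !pnatr_eq0 /= gtn_eqF //.
  have -> : g * ln n.+1%:R = g * ln n%:R + g * (ln n.+1%:R - ln n%:R) :> R by ring.
  rewrite expRD; move: (n.+1%:R) N1 => N N1.
  by field; rewrite !gt_eqF // ?addr_gt0.
rewrite ler_peMr ?(ltW (real_gamma_seq_gt0 g0 n0)) //.
rewrite ler_pdivlMr ?mul1r ?addr_gt0 ?divr_gt0 //.
apply: le_trans (expR_ge1Dx _) _; rewrite ler_expR ler_wpM2l ?(ltW g0) //.
by have /andP[] := @lnS_itv R n n0.
Qed.

Lemma realGammaD1 (g : R) : 0 < g -> realGamma (g + 1) = g * realGamma g.
Proof.
move=> g0.
have g1 : 0 < g + 1 by rewrite addr_gt0.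
have c1 := cvg_real_gamma_seq g1; apply: (cvg_unique _ c1) => //.
(* The two Euler sequences differ by the factor g n / (n + g + 1). *)
have c2 : (fun n : nat => g * real_gamma_seq g n * (1 - (g + 1) * (n%:R + (g + 1))^-1))
    @ \oo --> g * realGamma g * (1 - (g + 1) * 0).
  apply: cvgM; first by apply: cvgM; [exact: cvg_cst|exact: cvg_real_gamma_seq].
  apply: cvgB; first exact: cvg_cst.
  by apply: cvgM; [exact: cvg_cst|exact: cvg_natDV].
rewrite mulr0 subr0 mulr1 in c2; apply: cvg_trans c2; apply: near_eq_cvg; near=> n.
have n0 : (0 < n)%N by near: n; exists 1%N.
have N0 : 0 < n%:R :> R by rewrite ltr0n.
rewrite /real_gamma_seq powRD ?pnatr_eq0 -?lt0n ?n0 ?implybT // powRr1 ?(ltW N0) //.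
have r0 := rfact_gt0 n.+1 g0.
have -> : rfact (g + 1) n.+1 = rfact g n.+1 * (n%:R + (g + 1)) / g.
  rewrite /rfact big_ord_recr /= [in RHS]big_ord_recl /= addr0.
  have -> : \prod_(i < n) (g + (bump 0 i)%:R) = \prod_(i < n) (g + 1 + i%:R).
    by apply: eq_bigr => i _; rewrite /bump leq0n natrD addrA.
  by field; rewrite gt_eqF.
by field; rewrite !gt_eqF // ?addr_gt0.
Unshelve. all: by end_near. Qed.

Lemma realGamma1 : realGamma 1 = 1 :> R.
Proof.
have c1 := cvg_real_gamma_seq (@ltr01 R).
suff h : real_gamma_seq 1 @ \oo --> (1 : R) by exact: (cvg_unique _ c1 h).
have c2 : (fun n : nat => 1 - (n%:R + 1)^-1) @ \oo --> 1 - (0 : R).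
  by apply: cvgB; [exact: cvg_cst|exact: cvg_natDV].
rewrite subr0 in c2; apply: cvg_trans c2; apply: near_eq_cvg; near=> n.
have n0 : (0 < n)%N by near: n; exists 1%N.
have N0 : 0 < n%:R :> R by rewrite ltr0n.
rewrite /real_gamma_seq powRr1 ?(ltW N0) //.
have -> : rfact (1 : R) n.+1 = n.+1`!%:R.
  rewrite /rfact; elim: n.+1 => [|m IH]; first by rewrite big_ord0.
  by rewrite big_ord_recr /= IH factS natrM mulrC nat1r.
rewrite factS natrM -natr1 /=.
have f0 : (n`!)%:R != 0 :> R by rewrite pnatr_eq0 -lt0n fact_gt0.
by field; rewrite f0 gt_eqF // addr_gt0.
Unshelve. all: by end_near. Qed.

Lemma realGamma_fact (m : nat) : realGamma m.+1%:R = m`!%:R :> R.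
Proof.
elim: m => [|m IH]; first by rewrite realGamma1.
by rewrite -natr1 realGammaD1 ?ltr0n // IH factS natrM.
Qed.
End gamma_function.

(** * The functions rho *)

Section rho.
Variable R : realType.
Implicit Types x : R.

Lemma eq_iter_integral (b : nat) (f g : seq R -> \bar R) :
  (forall ys, size ys = b -> f ys = g ys) ->
  iter_integral b f = iter_integral b g.
Proof.
elim: b f g => [|b IH] f g fg /=; first exact: fg.
by apply: eq_integral => y _; apply: IH => ys yb; apply: fg; rewrite /= yb.
Qed.

Lemma ler_sum_seq_lb (ys : seq R) x : (forall t, t \in ys -> x < t) ->
  (size ys)%:R * x <= \sum_(t <- ys) t.
Proof.
elim: ys => [|y ys IH] ysx; first by rewrite big_nil mul0r.
rewrite big_cons -natr1 mulrDl mul1r addrC lerD //.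
  by apply/ltW/ysx; rewrite mem_head.
by apply: IH => t tys; apply: ysx; rewrite inE tys orbT.
Qed.

Lemma incDirichlet_eq0 (b : nat) (x rho : R) :
  (0 < b)%N -> 1 <= b%:R * x -> incDirichlet b x 0 1 rho = 0.
Proof.
case: b => // b _ bx; rewrite /incDirichlet.
rewrite (@eq_iter_integral _ _ (fun=> 0%E)) ?iter_integral0 ?mulr0 // => ys yb.
rewrite ifN //; apply/negP => /andP[/allP ysx].
by rewrite subr0 ltNge (le_trans bx) // -yb; exact: ler_sum_seq_lb.
Qed.

(** The normalising factor (m - 1)! / (m - k - 1)! is the inverse of the constant of the simplex
    integral. *)
Lemma incDirichletE (m k : nat) x : (k < m)%N ->
  incDirichlet k x 0 1 (m%:R - k%:R) =
  if k%:R * x < 1 then (1 - k%:R * x) ^+ m.-1 else 0.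
Proof.
case: k => [|k] km.
  by rewrite /= mul0r ltr01 subr0 expr1n.
rewrite /incDirichlet.
have mE : m = (m - k.+2).+1 + k.+1 :> nat by lia.
move: (m - k.+2)%N mE => e mE.
have mk : m%:R - k.+1%:R = e.+1%:R :> R by rewrite mE natrD addrK.
have mk' : e.+1%:R + k.+1%:R * 1 = m%:R :> R by rewrite mE mulr1 natrD.
rewrite mk mk' realGamma1 expr1n mulr1 realGamma_fact.
have -> : m%:R = (e + k.+1).+1%:R :> R by rewrite mE.
rewrite realGamma_fact (@eq_iter_integral _ _ (simplex_integrand x e 1)); last first.
  move=> ys _; rewrite /Delta /simplex_integrand subr0; case: ifP => // /andP[_ ys1].
  rewrite -natr1 addrK powR_mulrn ?subr_ge0 ?(ltW ys1) // subrr.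
  by rewrite [X in _ * X]big1 ?mulr1 // => i _; rewrite powRr0.
have -> : m.-1 = (e + k.+1)%N by rewrite mE.
rewrite iter_integral_simplex.
have f0 j : (j`!)%:R != 0 :> R by rewrite pnatr_eq0 -lt0n fact_gt0.
case: ifP => _; last by rewrite mulr0.

have E (a b c : R) : a != 0 -> b != 0 -> b / a * fine (a / b * c)%:E = c.
  by move=> a0 b0 /=; field; rewrite a0 b0.
exact: E.
Qed.

(** Only the ranges differ for m >= 2: the truncated power vanishes for k x > 1, and the whole sum
    vanishes for m x < 1. *)
Lemma rho_m1E (m : nat) x : (0 < m)%N -> 0 < x -> rho_m1 m x = simplex_max_cdf m x.
Proof.
move=> m0 x0; rewrite /rho_m1 ceil_le_int; case: ifPn => [xm|]; last first.
  rewrite -ltNge /= => mx; rewrite simplex_max_cdf_eq0 // ?ltW //.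
  by rewrite -ltr_pdivlMr // mul1r.
have {}xm : 1 <= m%:R * x by rewrite -ler_pdivrMr // mul1r.
have xV0 : 0 <= x^-1 by rewrite invr_ge0 ltW.
case: m m0 xm => // -[|m] _ xm.
  rewrite /= big_nat_recl // big_nat big1 => [|k _].
    by rewrite addr0 bin0 !mulr1 -[x]mul1r xm.
  rewrite incDirichlet_eq0 ?mulr0 //; apply: le_trans xm _.
  by rewrite ler_pM2r // ler_nat.
rewrite /simplex_max_cdf -(big_mkord xpredT (fun i => (-1) ^+ i * 'C(m.+2, i)%:R *
  Num.max 0 (1 - i%:R * x) ^+ m.+1)).
have tm : (Num.truncn x^-1 < m.+3)%N.
  by rewrite truncn_lt_nat // -div1r ltr_pdivrMr // (le_lt_trans xm) // ltr_pM2r // ltr_nat.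
rewrite [RHS](big_cat_nat (leq0n (Num.truncn x^-1).+1) tm) /=.
rewrite [X in _ = _ + X]big_nat [X in _ = _ + X]big1 ?addr0 => [|k /andP[tk _]]; last first.
  have xk : 1 < k%:R * x by rewrite -ltr_pdivrMr // div1r -truncn_lt_nat.
  by rewrite max_l ?expr0n ?mulr0 // subr_le0 ltW.
rewrite !big_nat; apply: eq_bigr => k /andP[_ kt]; congr (_ * _).
have km : (k <= m.+2)%N.
  have : (k <= Num.truncn x^-1)%N by [].
  rewrite truncn_ge_nat // -div1r ler_pdivlMr // => kx.
  rewrite -(ler_nat R) -(ler_pM2r x0); exact: le_trans kx xm.
move: km; rewrite leq_eqVlt => /predU1P[->|km].
  by rewrite incDirichlet_eq0 // max_l ?expr0n // subr_le0.
rewrite incDirichletE //; case: ltP => kx; first by rewrite max_r // subr_ge0 ltW.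
by rewrite max_l ?expr0n // subr_le0.
Qed.
End rho.

(** * Gnedin partitions *)

Lemma sum_ffact (j n : nat) :
  (\sum_(i < n) j.+1 * i ^_ j)%N = (n ^_ j.+1)%N.
Proof.
elim: n => [|n IH]; first by rewrite big_ord0.
rewrite big_ord_recr /= IH ffactSS ffactnSr.
have [jn|nj] := leqP j n; last by rewrite (ffact_small nj) !muln0 mul0n.
by rewrite [(j.+1 * _)%N]mulnC -mulnDr mulnC; congr (_ * _)%N; lia.
Qed.

(** The falling factorial is a sum of its increments; writing the part above [l] with an indicator
    lets expectations turn it into probabilities of l <= i. *)
Lemma ffactE_below (R : pzRingType) (j l n : nat) : (l <= n)%N ->
  (l ^_ j.+1)%:R = (n ^_ j.+1)%:R -
    \sum_(i < n) (j.+1 * i ^_ j)%:R * (l <= i)%N%:R :> R.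
Proof.
move=> ln; apply/eqP; rewrite eq_sym subr_eq -!sum_ffact !natr_sum.
rewrite -!(big_mkord xpredT (fun i => (j.+1 * i ^_ j)%:R : R)).
rewrite -(big_mkord xpredT (fun i => (j.+1 * i ^_ j)%:R * (l <= i)%N%:R : R)).
rewrite !(big_cat_nat (leq0n l) ln) /=.
rewrite [X in _ == _ + (X + _)]big_nat [X in _ == _ + (X + _)]big1; last first.
  by move=> i /andP[_ il]; rewrite leqNgt il mulr0.
rewrite add0r; apply/eqP; congr (_ + _).
rewrite !big_nat; apply: eq_bigr => i /andP[li _]; by rewrite li mulr1.
Qed.

Section gnedin_sums.
Variables (R : realType) (g z : R) (n : nat).
Hypotheses (g0 : 0 < g) (adm : admissible g z) (n0 : (0 < n)%N).

Definition gnedin_mass (pi : {set {set 'I_n}}) : R :=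
  gnedin_v g z n #|pi| * \prod_(A in pi) (#|A|)`!%:R.

Lemma card_partition_le pi : finset.partition pi [set: 'I_n]%SET -> (#|pi| <= n)%N.
Proof.
move=> pip; have := card_partition pip; rewrite cardsT card_ord => nE.
apply: (@leq_trans (\sum_(A in pi) #|A|)); last by rewrite -nE.
rewrite -sum1_card; apply: leq_sum => A Api.
by rewrite card_gt0 (partition_neq0 pip Api).
Qed.

Lemma block_law_boundedE r k :
  block_law g z n k * bounded_fraction R r n k =
  gnedin_v g z n k * (n`!%:R / k`!%:R * (compositions r n k)%:R).
Proof.
rewrite /block_law /lah /bounded_fraction -!mulrA; congr (_ * (_ * (_ * _))).
have := leq_compositions r n k; case: (posnP (all_compositions n k)) => [->|c0 _].
  by rewrite leqn0 => /eqP->; rewrite mul0r.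
by rewrite [X in _ * (_ * X) = _]mulrCA divff ?mulr1 // pnatr_eq0 -lt0n.
Qed.

Lemma sum_gnedin_mass r :
  \sum_(pi | finset.partition pi [set: 'I_n]%SET && (largest_block pi <= r)%N)
     gnedin_mass pi =
  \sum_(k < n.+1) block_law g z n k * bounded_fraction R r n k.
Proof.
rewrite (partition_big (fun pi : {set {set 'I_n}} => (inord #|pi| : 'I_n.+1)) xpredT) //=.
apply: eq_bigr => k _; rewrite block_law_boundedE.
have f0 m : (m`!)%:R != 0 :> R by rewrite pnatr_eq0 -lt0n fact_gt0.
have -> : n`!%:R / k`!%:R * (compositions r n k)%:R =
   (partition_weight r k [set: 'I_n]%SET)%:R :> R.
  apply: (mulfI (f0 k)); rewrite mulrA [_ * (_ / _)]mulrCA divff // mulr1.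
  by rewrite -!natrM partition_weightE cardsT card_ord.
rewrite /partition_weight natr_sum mulr_sumr.
apply: eq_big => [pi|pi].
  rewrite /partition_with -andbA; case: (boolP (finset.partition _ _)) => //= pip.
  rewrite andbC -val_eqE /= inordK ?ltnS ?card_partition_le //; congr (_ && _).
  apply/bigmax_leqP/forall_inP => H A Api; exact: H.
case/andP => /andP[pip _]; rewrite -val_eqE /= inordK ?ltnS ?card_partition_le // => /eqP kE.
by rewrite /gnedin_mass kE natr_prod.
Qed.

Section expectation.
Variables (d : measure_display) (T : measurableType d) (P : probability T R).
Variable Pi : T -> {set {set 'I_n}}.
Hypothesis PiP : gnedin_partition g z P Pi.

Lemma gnedin_preimage pi :
  measurable (Pi @^-1` [set pi]) /\
  P (Pi @^-1` [set pi]) =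
    (if finset.partition pi [set: 'I_n]%SET then gnedin_mass pi else 0)%:E.
Proof.
case: PiP => Pip PiE; case: ifPn => [/PiE //|npi].
rewrite (_ : Pi @^-1` _ = set0) ?measure0 //; apply/seteqP; split => // w /= wE.
by rewrite -wE Pip in npi.
Qed.

Lemma measurable_gnedin (Q : pred {set {set 'I_n}}) : measurable [set w | Q (Pi w)].
Proof.
have -> : [set w | Q (Pi w)] = \bigcup_(pi in [set pi | Q pi]) (Pi @^-1` [set pi]).
  by apply/seteqP; split => [w Qw|w [pi Qpi] /= ->//]; exists (Pi w).
by apply: fin_bigcup_measurable => // pi _; case: (gnedin_preimage pi).
Qed.

(** [Pi] takes finitely many values on measurable fibres, so any nonnegative statistic is a finite
    combination of indicators. *)
Lemma integral_gnedin (f : {set {set 'I_n}} -> R) : (forall pi, 0 <= f pi) ->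
  (\int[P]_w (f (Pi w))%:E =
   (\sum_(pi | finset.partition pi [set: 'I_n]%SET) gnedin_mass pi * f pi)%:E)%E.
Proof.
move=> f0.
transitivity (\int[P]_w (\sum_(pi : {set {set 'I_n}})
    ((f pi)%:E * (\1_(Pi @^-1` [set pi]) w)%:E)))%E.
  apply: eq_integral => w _.
  rewrite (bigD1 (Pi w)) //= indicE mem_set //= mule1.
  rewrite big1 ?adde0 // => pi piw; rewrite indicE memNset ?mule0 //=.
  by move=> wE; rewrite wE eqxx in piw.
have mI pi : measurable_fun [set: T] (fun w => (\1_(Pi @^-1` [set pi]) w)%:E : \bar R).
  by apply/measurable_EFinP; apply: measurable_indic; case: (gnedin_preimage pi).
rewrite ge0_integral_sum //; last 2 first.
- by move=> pi; apply: measurable_funeM.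
- by move=> pi w _; rewrite mule_ge0 ?lee_fin.
rewrite -sumEFin [RHS]big_mkcond /=; apply: eq_bigr => pi _.
rewrite ge0_integralZl ?lee_fin //.
have [mpi Ppi] := gnedin_preimage pi.
rewrite integral_indic // setIT.
transitivity ((f pi)%:E * (if finset.partition pi [set: 'I_n]%SET then gnedin_mass pi else 0)%:E)%E.
  by congr (_ * _)%E; exact: Ppi.
case: ifP => _; last by rewrite mule0.
by rewrite -EFinM mulrC.
Qed.

Lemma probability_gnedin r :
  fine (P [set w | (largest_block (Pi w) <= r)%N]) =
  \sum_(k < n.+1) block_law g z n k * bounded_fraction R r n k.
Proof.
rewrite -sum_gnedin_mass big_mkcondr /=.
have mS := measurable_gnedin (fun pi => largest_block pi <= r)%N.
transitivity (fine (\int[P]_w (\1_[set w | (largest_block (Pi w) <= r)%N] w)%:E)).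
  by congr fine; rewrite (integral_indic P measurableT mS) setIT.
have := @integral_gnedin (fun pi => (largest_block pi <= r)%N%:R) (fun _ => ler0n _ _).
move=> /(congr1 fine) /= E; transitivity (fine (\int[P]_w ((largest_block (Pi w) <= r)%N%:R : R)%:E)).
  congr fine; apply: eq_integral => w _; rewrite indicE; congr (_%:R)%:E.
  by rewrite mem_setE.
rewrite E; apply: eq_bigr => pi _.
by case: (_ <= r)%N; rewrite ?mulr1 ?mulr0.
Qed.

(** Given [k] blocks, this is the amount by which the expectation of [L]_(j+1) falls short of its
    maximum [n]_(j+1), over n^(j+1). *)
Definition moment_defect j k : R :=
  (\sum_(i < n) (j.+1 * i ^_ j)%:R * bounded_fraction R i n k) / n%:R ^+ j.+1.

Lemma largest_block_le (pi : {set {set 'I_n}}) : (largest_block pi <= n)%N.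
Proof. by apply/bigmax_leqP => A _; rewrite -[leqRHS]card_ord max_card. Qed.

Lemma sum_gnedin_mass1 :
  \sum_(pi | finset.partition pi [set: 'I_n]%SET) gnedin_mass pi = 1.
Proof.
have := @integral_gnedin (fun=> 1) (fun _ => ler01).
rewrite integral_cst //= probability_setT mule1 => -[->].
by apply: eq_bigr => pi _; rewrite mulr1.
Qed.

Lemma expectation_gnedin j :
  fine ('E_P[fun w => (largest_block (Pi w) ^_ j.+1)%:R / n%:R ^+ j.+1]) =
  (n ^_ j.+1)%:R / n%:R ^+ j.+1 -
    \sum_(k < n.+1) block_law g z n k * moment_defect j k.
Proof.
rewrite unlock.
rewrite (@integral_gnedin (fun pi => (largest_block pi ^_ j.+1)%:R / n%:R ^+ j.+1)); last first.
  by move=> pi; rewrite divr_ge0 // exprn_ge0.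
rewrite [fine _]/=.
under eq_bigr => pi _ do rewrite (ffactE_below R j (largest_block_le pi)) mulrA mulrBr.
rewrite -mulr_suml sumrB -mulr_suml sum_gnedin_mass1 mul1r mulrBl; congr (_ - _).
rewrite /moment_defect.
under [in RHS]eq_bigr => k _ do rewrite mulrA mulr_sumr.
rewrite -mulr_suml exchange_big /=; congr (_ / _).
under eq_bigr => pi _ do rewrite mulr_sumr.
rewrite exchange_big /=; apply: eq_bigr => i _.
under [in RHS]eq_bigr => k _ do rewrite mulrCA.
rewrite -mulr_sumr -sum_gnedin_mass mulr_sumr [RHS]big_mkcondr /=.
apply: eq_bigr => pi _; rewrite mulrCA.
by case: (_ <= i)%N; rewrite ?mulr1 ?mulr0.
Qed.
End expectation.
End gnedin_sums.

(** * Moments *)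

Section moments.
Variable R : realType.
Local Notation mu := (@lebesgue_measure R).

Definition grid_cell (n i : nat) : set R := `[(i%:R / n%:R), (i.+1%:R / n%:R)[%classic.

Definition grid_step (n : nat) (a : nat -> R) (x : R) : R :=
  \sum_(i < n) a i * \1_(grid_cell n i) x.

Lemma grid_stepE (n : nat) (a : nat -> R) (x : R) : (0 < n)%N -> 0 <= x < 1 ->
  grid_step n a x = a (Num.truncn (x * n%:R)).
Proof.
move=> n0 /andP[x0 x1]; have N0 : 0 < n%:R :> R by rewrite ltr0n.
have xn0 : 0 <= x * n%:R by rewrite mulr_ge0 // ltW.
have /andP[t1 t2] := truncn_itv xn0.
have tn : (Num.truncn (x * n%:R) < n)%N.
  by rewrite truncn_lt_nat // -[ltRHS]mul1r ltr_pM2r.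
rewrite /grid_step (bigD1 (Ordinal tn)) //= big1 => [|i /eqP it].
  rewrite addr0 indicE mem_set ?mulr1 // /grid_cell /= in_itv /=.
  by rewrite ler_pdivrMr // ltr_pdivlMr // t1 t2.
rewrite indicE memNset ?mulr0 // /grid_cell /= in_itv /= ler_pdivrMr // ltr_pdivlMr // => /andP[i1 i2].
apply: it; apply/val_inj => /=; apply/eqP; rewrite eqn_leq.
by rewrite truncn_ge_nat // i1 /= -ltnS truncn_lt_nat.
Qed.

Lemma measurable_grid_step (n : nat) (a : nat -> R) (D : set R) :
  measurable_fun D (grid_step n a).
Proof.
rewrite /grid_step; apply: measurable_sum => i.
apply: measurable_funM => //; apply: measurable_indic; exact: measurable_itv.
Qed.

Lemma integral_grid_step (n : nat) (a : nat -> R) : (forall i, 0 <= a i) ->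
  (\int[mu]_(x in `[0%R, 1%R[) (grid_step n a x)%:E = (\sum_(i < n) a i / n%:R)%:E)%E.
Proof.
move=> a0.
have mI (i : nat) D : measurable_fun D (fun w => (\1_(grid_cell n i) w)%:E : \bar R).
  by apply/measurable_EFinP; apply: measurable_indic; exact: measurable_itv.
transitivity (\int[mu]_(x in `[0%R, 1%R[)
   (\sum_(i < n) ((a i)%:E * (\1_(grid_cell n i) x)%:E)))%E.
  by apply: eq_integral => x _; rewrite -sumEFin; apply: eq_bigr => i _; rewrite EFinM.
rewrite ge0_integral_sum //; last 2 first.
- by move=> i; apply: measurable_funeM; exact: mI.
- by move=> i x _; rewrite mule_ge0 ?lee_fin.
rewrite -sumEFin; apply: eq_bigr => i _.
rewrite ge0_integralZl ?lee_fin //; last exact: mI.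
rewrite integral_indic //; last exact: measurable_itv.
have n0 : 0 < n%:R :> R by rewrite ltr0n (leq_trans _ (ltn_ord i)).
rewrite setIidl; last first.
  move=> x; rewrite /grid_cell /= !in_itv /= ler_pdivrMr // ltr_pdivlMr // => /andP[x1 x2].
  apply/andP; split.
    by rewrite -(pmulr_lge0 _ n0) (le_trans _ x1).
  by rewrite -(ltr_pM2r n0) mul1r (lt_le_trans x2) // ler_nat.
have E : (mu (grid_cell n i) = (i.+1%:R / n%:R)%:E - (i%:R / n%:R)%:E)%E.
  apply: etrans (lebesgue_measure_itv _) _.
  by rewrite /= lte_fin ltr_pM2r ?invr_gt0 // ltr_nat ltnSn.
transitivity ((a i)%:E * mu (grid_cell n i))%E; first by [].
by rewrite E -EFinB -EFinM -mulrBl -natr1 addrAC subrr add0r mul1r.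
Qed.

Definition moment_coef (n k j i : nat) : R :=
  (i ^_ j)%:R / n%:R ^+ j * bounded_fraction R i n k.

Lemma moment_coef_ge0 n k j i : 0 <= moment_coef n k j i.
Proof. by rewrite /moment_coef mulr_ge0 ?divr_ge0 ?exprn_ge0.
Qed.

Lemma ffact_le_exp (i n j : nat) : (i <= n)%N -> (i ^_ j <= n ^ j)%N.
Proof.
move=> le_in; elim: j => // j IH; rewrite ffactnSr expnSr leq_mul //.
exact: leq_trans (leq_subr _ _) le_in.
Qed.

Lemma moment_coef_le1 n k j i : (i < n)%N -> moment_coef n k j i <= 1.
Proof.
move=> i_n; have /andP[b0 b1] := bounded_fraction01 R i n k.
rewrite /moment_coef -[leRHS]mulr1 ler_pM ?divr_ge0 ?exprn_ge0 //.
rewrite ler_pdivrMr ?exprn_gt0 ?ltr0n ?(leq_ltn_trans _ i_n) // mul1r -natrX ler_nat.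
by rewrite ffact_le_exp // ltnW.
Qed.

Lemma moment_defectE n k j : (0 < n)%N ->
  moment_defect R n j k = j.+1%:R * \sum_(i < n) moment_coef n k j i / n%:R.
Proof.
move=> n0; have N0 : n%:R != 0 :> R by rewrite pnatr_eq0 -lt0n.
rewrite /moment_defect mulr_suml mulr_sumr; apply: eq_bigr => i _.
by rewrite /moment_coef natrM exprSr; field; rewrite N0 expf_neq0.
Qed.

Lemma moment_defect01 n k j : (0 < n)%N -> 0 <= moment_defect R n j k <= 1.
Proof.
move=> n0; have N0 : 0 < n%:R :> R by rewrite ltr0n.
have b i := bounded_fraction01 R i n k.
rewrite /moment_defect divr_ge0 ?exprn_ge0 //=; last first.
  by apply: sumr_ge0 => i _; rewrite mulr_ge0 //; case/andP: (b i).
rewrite ler_pdivrMr ?exprn_gt0 // mul1r.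
apply: (@le_trans _ _ (n ^_ j.+1)%:R); last by rewrite -natrX ler_nat ffact_le_exp.
rewrite -sum_ffact natr_sum; apply: ler_sum => i _.
by rewrite ler_piMr //; case/andP: (b i).
Qed.

Definition simplex_moment_fun (j k : nat) (x : R) : R := x ^+ j * simplex_max_cdf k x.

Lemma cvg_grid_step j k x : (0 < k)%N -> 0 <= x < 1 ->
  (fun n => grid_step n (moment_coef n k j) x) @ \oo --> simplex_moment_fun j k x.
Proof.
move=> k0 /andP[x0 x1].
have rx := cvg_truncn_ratio x0.
have c : (fun n => moment_coef n k j (Num.truncn (x * n%:R))) @ \oo -->
    simplex_moment_fun j k x.
  apply: cvgM; first exact: cvgn_ffact.
  by apply: cvg_bounded_fraction => // _; rewrite lt_eqF.
apply: cvg_trans c; apply: near_eq_cvg; near=> n.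
by rewrite grid_stepE ?x0 //; near: n; exists 1%N.
Unshelve. all: by end_near. Qed.

(** Measurability comes for free from the step functions that converge pointwise. *)
Lemma simplex_moment_measurable j k : (0 < k)%N ->
  measurable_fun (`[0%R, 1%R[%classic : set R) (fun x => (simplex_moment_fun j k x)%:E).
Proof.
move=> k0.
apply: (@emeasurable_fun_cvg _ _ _ _
  (fun n x => (grid_step n (moment_coef n k j) x)%:E)).
- by move=> n; apply/measurable_EFinP; exact: measurable_grid_step.
- move=> x; rewrite /= in_itv /= => x01; apply: cvg_EFin; first exact: nearW.
  exact: cvg_grid_step.
Qed.

Lemma cvg_moment_defect j k : (0 < k)%N ->
  (fun n => moment_defect R n j k) @ \oo --> j.+1%:R * mu_m1 R j k.
Proof.
move=> k0.
have mF := simplex_moment_measurable j k0.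
have muE : mu_m1 R j k = fine (\int[mu]_(x in `[0%R, 1%R[) (simplex_moment_fun j k x)%:E).
  rewrite /mu_m1 /Rintegral; congr fine.
  (* [rho_m1E] needs x > 0 and the step functions live on [0, 1); the two endpoints are removed as
     null sets. *)
  have eqF : {in `]0%R, 1%R[%classic : set R, forall x,
     (simplex_moment_fun j k x)%:E = (x ^+ j * rho_m1 k x)%:E}.
    by move=> x; rewrite mem_setE in_itv /= => /andP[x0 _]; rewrite rho_m1E.
  have mF' : measurable_fun (`]0%R, 1%R[%classic : set R) (fun x => (simplex_moment_fun j k x)%:E).
    apply: measurable_funS mF; first exact: measurable_itv.
    by move=> x /=; rewrite !in_itv /= => /andP[/ltW-> ->].
  rewrite (@integral_itv_bndoo _ 0 1 _ true false); last exact: eq_measurable_fun mF'.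
  rewrite (@integral_itv_bndoo _ 0 1 _ true true) //.
  by apply: eq_integral => x xD; rewrite eqF.
have bnd n x : (`[0%R, 1%R[%classic : set R) x ->
    (`|(grid_step n (moment_coef n k j) x)%:E| <= cst 1%:E x)%E.
  rewrite /= in_itv /= => x01; rewrite lee_fin.
  case: (posnP n) => [->|n0]; first by rewrite /grid_step big_ord0 normr0.
  rewrite grid_stepE // ger0_norm ?moment_coef_ge0 // moment_coef_le1 //.
  case/andP: x01 => x0 x1.
  by rewrite truncn_lt_nat ?mulr_ge0 // -[ltRHS]mul1r ltr_pM2r ?ltr0n.
have i1 : mu.-integrable (`[0%R, 1%R[%classic : set R) (cst 1%:E).
  apply/integrableP; split; first exact: measurable_cst.
  under eq_integral do rewrite /= normr1.
  rewrite integral_cst; last exact: measurable_itv.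
  have mu01 : (mu (`[0%R, 1%R[%classic : set R) = 1%:E)%E.
    by apply: etrans (lebesgue_measure_itv _) _; rewrite /= lte_fin ltr01 oppr0 adde0.
  by rewrite mul1e; apply: (@le_lt_trans _ _ 1%:E%E); [rewrite -mu01|rewrite ltry].
have [] := @dominated_convergence _ _ _ mu (`[0%R, 1%R[%classic : set R) (measurable_itv _)
  (fun n x => (grid_step n (moment_coef n k j) x)%:E)
  (fun x => (simplex_moment_fun j k x)%:E) (cst 1%:E) _ mF _ i1.
- by move=> n; apply/measurable_EFinP; exact: measurable_grid_step.
- apply: aeW => x; rewrite /= in_itv /= => x01; apply: cvg_EFin; first exact: nearW.
  exact: cvg_grid_step.
- by apply: aeW => x n; exact: bnd.
move=> iF _ c.
have finF : (\int[mu]_(x in `[0%R, 1%R[) (simplex_moment_fun j k x)%:E \is a fin_num)%E.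
  by apply: integrable_fin_num iF; exact: measurable_itv.
rewrite -(fineK finF) in c; move/fine_cvgP : c => [_ c].
rewrite muE.
apply: (@cvg_trans _ ((fun n => j.+1%:R * fine (\int[mu]_(x in `[0%R, 1%R[)
    (grid_step n (moment_coef n k j) x)%:E)%E) @ \oo)); last first.
  by apply: cvgM; [exact: cvg_cst|exact: c].
apply: near_eq_cvg; near=> n.
have n0 : (0 < n)%N by near: n; exists 1%N.
rewrite moment_defectE // /= integral_grid_step //.
by move=> i; exact: moment_coef_ge0.
Unshelve. all: by end_near. Qed.
End moments.

(** * Limits and constants *)

Section asymptotics.
Variable R : realType.

Lemma asymp_equiv_ratio (r : nat -> nat) (x : R) : 0 < x ->
  asymp_equiv (fun n => (r n)%:R) (fun n => x * n%:R) ->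
  (fun n => (r n)%:R / n%:R) @ \oo --> x.
Proof.
move=> x0 /eqaddoP h; apply/cvgrPdist_le => e e0.
have ex : 0 < e / x by rewrite divr_gt0.
have := h _ ex; apply: filter_app; near=> n => H.
have n0 : 0 < n%:R :> R by rewrite ltr0n; near: n; exists 1%N.
have {H} : `|(r n)%:R - x * n%:R| <= e / x * `|x * n%:R| by exact: H.
rewrite [`|x * _|]ger0_norm ?mulr_ge0 ?(ltW x0) ?(ltW n0) // mulrA divfK ?gt_eqF // => H.
rewrite -(ler_pM2r n0) -[X in _ * X](ger0_norm (ltW n0)) -normrM mulrBl divfK ?gt_eqF //.
by rewrite distrC.
Unshelve. all: by end_near. Qed.

(** The error must be small relative to |S|; equivalence to 0 would require [u] to vanish
    eventually. *)
Lemma cvg_asymp_equiv (u : nat -> R) (S : R) (L : R[i]) : S != 0 -> L = S%:C ->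
  u @ \oo --> S -> asymp_equiv (fun n => (u n)%:C) (fun=> L).
Proof.
move=> S0 -> uS; apply/eqaddoP => -[e e'] /[!ltcE] /= /andP[/eqP -> e0].
have eS : 0 < e * `|S| by rewrite mulr_gt0 // normr_gt0.
move/cvgrPdist_le/(_ _ eS) : uS; apply: filterS => n H.
have -> : (((fun n => (u n)%:C : R[i]^o) - (fun=> S%:C)) n : R[i]) = (u n - S)%:C.
  by rewrite rmorphB.
have nE (y : R) : `|y%:C : R[i]| = `|y|%:C.
  by rewrite -[LHS]/((ComplexField.Normc.normc y%:C)%:C) normc_real.
have -> : e +i* 0 = e%:C by [].
by rewrite !nE -rmorphM lecR distrC.
Qed.

Lemma infsum_real (m0 : nat) (u : nat -> R[i]) (v : nat -> R) (S : R) :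
  (forall m, (m0 <= m)%N -> u m = (v m)%:C) ->
  (fun n => \sum_(m0 <= m < n) v m) @ \oo --> S ->
  infsum m0 u = S%:C.
Proof.
move=> uv vS; apply: complex_cvg_lim.
have c := cvg_real_complex vS; apply: cvg_trans c; apply: near_eq_cvg.
apply: nearW => n; rewrite rmorph_sum /= !big_nat; apply: eq_bigr => m /andP[mm _].
by rewrite uv.
Qed.
End asymptotics.

(** * Beta function and coefficients of the limit *)

Section gnedin_constants.
Variables (R : realType) (g z : R).
Hypotheses (g0 : 0 < g) (adm : admissible g z).

(** Only the sum and the product of the pair enter, so complex roots give a real value. It is
    applied with c = g for the z's and c = -g for the s's. *)
Lemma rfact_pair (u v : R[i]) (c : R) (m : nat) : u * v = z%:C -> u + v = c%:C ->
  rfact u m.+1 * rfact v m.+1 =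
    (z * \prod_(1 <= j < m.+1) (j%:R ^+ 2 + c * j%:R + z))%:C.
Proof.
move=> uv uDv; rewrite /rfact -big_split /= big_ord_recl /= !addr0 uv.
rewrite rmorphM rmorph_prod; congr (_ * _).
rewrite big_add1 /= big_mkord; apply: eq_bigr => i _; rewrite /bump leq0n add1n.
have -> : (u + i.+1%:R) * (v + i.+1%:R) = i.+1%:R ^+ 2 + (u + v) * i.+1%:R + u * v by ring.
by rewrite uv uDv !rmorphD rmorphXn rmorphM !rmorph_nat.
Qed.

Variables (z1 z2 s1 s2 : R[i]).
Hypotheses (z1z2 : z1 * z2 = z%:C) (s1s2 : s1 * s2 = z%:C).
Hypotheses (z1Dz2 : z1 + z2 = g%:C) (s1Ds2 : - (s1 + s2) = g%:C).
Hypotheses (z1p : ~ Gamma_pole z1) (z2p : ~ Gamma_pole z2).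

Lemma zeta_neq0 : z != 0.
Proof.
apply/eqP => z0; move: z1z2; rewrite z0 => /eqP; rewrite mulf_eq0 => /orP[]/eqP w0.
  by apply: z1p; exists 0%N; rewrite w0 oppr0.
by apply: z2p; exists 0%N; rewrite w0 oppr0.
Qed.

Lemma gnedin_coefE (m : nat) : (0 < m)%N ->
  gnedin_coef s1 s2 m = (z * block_coef g z m)%:C.
Proof.
case: m => // m _; rewrite /gnedin_coef (@rfact_pair _ _ (- g)) //; last first.
  by apply: oppr_inj; rewrite s1Ds2 -rmorphN opprK.
rewrite (natr_complex _ (m.+1)`!) (natr_complex _ (m.+1.-1)`!) -rmorphM -fmorphV -rmorphM.
rewrite /block_coef /neg_prod -mulrA; congr ((_ * (_ / _))%:C).
by apply: eq_bigr => i _; rewrite mulNr.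
Qed.

(** In the quotient of the three Euler sequences the powers of n cancel, leaving exactly
    [block_norm g z n / z]. Being a limit of reals, the Beta value is real. *)
Lemma cvg_block_norm : exists2 a : R, block_norm g z @ \oo --> a &
  Beta z1 z2 = (a / z)%:C.
Proof.
have gp : ~ Gamma_pole (z1 + z2) by rewrite z1Dz2; exact: real_pole_neq.
have G0 : Gamma (z1 + z2) != 0.
  rewrite z1Dz2 Gamma_real //; apply/eqP => /(congr1 (@complex.Re R)) /= e.
  by have := realGamma_gt0 g0; rewrite e ltxx.
have c : (fun n => gamma_seq z1 n * gamma_seq z2 n / gamma_seq (z1 + z2) n : R[i]^o)
    @ \oo --> (Beta z1 z2 : R[i]^o).
  apply: cvgM; first by apply: cvgM; exact: cvg_gamma_seq.
  by apply: cvgV => //; exact: cvg_gamma_seq.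
have {}c : (fun n => (block_norm g z n / z)%:C : R[i]^o) @ \oo --> (Beta z1 z2 : R[i]^o).
  apply: cvg_trans c; apply: near_eq_cvg; near=> n.
  have n0 : (0 < n)%N by near: n; exists 1%N.
  have r1 := rfact_neq0 n.+1 z1p.
  have r2 := rfact_neq0 n.+1 z2p.
  have r3 := rfact_neq0 n.+1 gp.
  have f0 : (n`!)%:R != 0 :> R[i] by rewrite pnatr_eq0 -lt0n fact_gt0.
  have -> : gamma_seq z1 n * gamma_seq z2 n / gamma_seq (z1 + z2) n =
     n`!%:R * rfact (z1 + z2) n.+1 / (rfact z1 n.+1 * rfact z2 n.+1).
    rewrite /gamma_seq !natcpowE // cis_exp_add.
    have c0 w (L : R) : cis_exp w L != 0.
      apply/eqP => /eqP; rewrite eq_complex /= !mulf_eq0 gt_eqF ?expR_gt0 //=.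
      move=> /andP[/eqP c0 /eqP s0]; have := cos2Dsin2 (complex.Im w * L).
      by rewrite c0 s0 expr0n /= addr0 => /esym/eqP; rewrite oner_eq0.
    have := c0 z1 (ln n%:R); have := c0 z2 (ln n%:R).
    move: (cis_exp z1 _) (cis_exp z2 _) => P Q P0 Q0.
    by field; rewrite r1 r2 r3 f0 P0 Q0.
  rewrite (rfact_pair n z1z2 z1Dz2) z1Dz2 -/(pos_prod g z n.+1) /block_norm.
  have -> : rfact g%:C n.+1 = (rfact g n.+1)%:C.
    by rewrite /rfact rmorph_prod; apply: eq_bigr => i _; rewrite rmorphD rmorph_nat.
  rewrite natr_complex -rmorphM -fmorphV -rmorphM; congr (_%:C).
  by rewrite invfM [z^-1 * _]mulrC mulrA.
have /= cr := cvg_Re c.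
exists (z * complex.Re (Beta z1 z2)).
  have {}cr : (fun n => z * (block_norm g z n / z)) @ \oo --> z * complex.Re (Beta z1 z2).
    by apply: cvgM => //; exact: cvg_cst.
  apply: cvg_trans cr; apply: near_eq_cvg; apply: nearW => n.
  by rewrite mulrC divfK // zeta_neq0.
rewrite mulrAC divff ?zeta_neq0 // mul1r.
by rewrite -[LHS](complex_cvg_lim c) (complex_cvg_lim (cvg_real_complex cr)).
Unshelve. all: by end_near. Qed.

(** Each coefficient is [z * block_coef] and Beta is [a / z], so their product is the limit law. The
    scalar [c] is 1 for the distribution function and the order of the moment otherwise. *)
Lemma Beta_infsum (a c S : R) (m0 : nat) (f h : nat -> R) :
  block_norm g z @ \oo --> a -> Beta z1 z2 = (a / z)%:C -> c != 0 -> (0 < m0)%N ->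
  (forall m, (0 < m)%N -> h m = c * f m) -> (forall m, (0 < m < m0)%N -> f m = 0) ->
  series (fun k => limit_law g z a k * h k) @ \oo --> S ->
  Beta z1 z2 * c%:C * infsum m0 (fun m => gnedin_coef s1 s2 m * (f m)%:C) = S%:C.
Proof.
move=> ba BE c0 m00 hf f0 hS.
have a0 := lt0r_neq0 (block_norm_lim_gt0 g0 adm ba).
have z0 := zeta_neq0.
rewrite (@infsum_real _ _ _ (fun m => z / (a * c) * (limit_law g z a m * h m))
   (z / (a * c) * S)).
- rewrite BE -!rmorphM; congr (_%:C); by field; rewrite a0 z0 c0.
- move=> m mm; have m1 : (0 < m)%N := leq_trans m00 mm.
  rewrite gnedin_coefE // -rmorphM hf //; congr (_%:C).
  by case: m m1 {mm} => // m _; rewrite /limit_law; field; rewrite a0 c0.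
have {}hS : (fun n => z / (a * c) * series (fun k => limit_law g z a k * h k) n) @ \oo -->
   z / (a * c) * S by apply: cvgM => //; exact: cvg_cst.
apply: cvg_trans hS; apply: near_eq_cvg; near=> n.
have m0n : (m0 <= n)%N by near: n; exists m0.
rewrite -mulr_sumr; congr (_ * _); rewrite /series /= (big_cat_nat (leq0n m0) m0n) /=.
rewrite [X in X + _]big_nat [X in X + _]big1 ?add0r // => m /andP[_ mm].
case: m mm => [|m] mm; first by rewrite /limit_law mul0r.
by rewrite hf // f0 ?mulr0.
Unshelve. all: by end_near. Qed.
End gnedin_constants.

Theorem corollary4p6 (R : realType) (gamma zeta : R)
    (gamma_ge0 : 0 <= gamma)
    (gz_gt0 : forall j : nat, (1 <= j)%N ->
       0 < j%:R ^+ 2 - gamma * j%:R + zeta)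
    (d : nat -> measure_display) (T : forall n, measurableType (d n))
    (P : forall n, probability (T n) R)
    (Pi : forall n, T n -> {set {set 'I_n}})
    (PiP : forall n, gnedin_partition gamma zeta (P n) (@Pi n))
    (z1 z2 s1 s2 : R[i])
    (z1z2 : z1 * z2 = zeta%:C) (s1s2 : s1 * s2 = zeta%:C)
    (z1Dz2 : z1 + z2 = gamma%:C) (s1Ds2 : - (s1 + s2) = gamma%:C)
    (z1_pole : ~ Gamma_pole z1) (z2_pole : ~ Gamma_pole z2)
    (z1Dz2_pole : ~ Gamma_pole (z1 + z2)) :
  (forall (x : R) (r : nat -> nat), 0 < x -> x != 1 ->
     asymp_equiv (fun n => (r n)%:R) (fun n => x * n%:R) ->
     asymp_equiv
       (fun n => (fine (P n [set w | (largest_block (Pi n w) <= r n)%N]))%:C)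
       (fun=> Beta z1 z2 *
          infsum `|Num.ceil x^-1|%N
            (fun m => gnedin_coef s1 s2 m * (rho_m1 m x)%:C)))
  /\
  (forall j : nat, (1 <= j)%N ->
     asymp_equiv
       (fun n => (fine ('E_(P n)[fun w =>
          (largest_block (Pi n w) ^_ j)%:R / n%:R ^+ j]))%:C)
       (fun=> 1 - Beta z1 z2 * j%:R *
          infsum 2 (fun m => gnedin_coef s1 s2 m * (mu_m1 R j.-1 m)%:C))).
Proof.
have g0 : 0 < gamma.
  rewrite lt0r gamma_ge0 andbT; apply/eqP => gamma0; apply: z1Dz2_pole.
  by exists 0%N; rewrite z1Dz2 gamma0 oppr0.
have [a ba BE] := cvg_block_norm g0 z1z2 z1Dz2 z1_pole z2_pole.
have law_ge0 := limit_law_ge0 g0 gz_gt0 ba.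
have law_gt0 := limit_law_gt0 g0 gz_gt0 ba.
have coef_sum := Beta_infsum g0 gz_gt0 z1z2 s1s2 s1Ds2 z1_pole z2_pole ba BE.
split => [x r x0 x1 rx|[//|j] _].
  have rxn := asymp_equiv_ratio x0 rx.
  have [cS cP] := cvg_block_mixture g0 gz_gt0 ba
    (fun n k => bounded_fraction01 R (r n) n k)
    (fun k k0 => cvg_bounded_fraction k0 (fun _ => x1) rxn).
  set S := limn _ in cP.
  have rho_ge0 k : (0 < k)%N -> 0 <= simplex_max_cdf k x.
    move=> k0; apply: (cvgr_to_ge (cvg_bounded_fraction k0 (fun _ => x1) rxn)).
    by apply: nearW => n; case/andP: (bounded_fraction01 R (r n) n k).
  have term_ge0 k : 0 <= limit_law gamma zeta a k * simplex_max_cdf k x.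
    by case: k => [|k]; [rewrite mul0r|rewrite mulr_ge0 ?rho_ge0].
  (* All terms are nonnegative, so a single positive one bounds the limit away from 0. *)
  have S0 : S != 0.
    have [k kx] := simplex_max_cdf_ex_gt0 x0.
    apply: lt0r_neq0; apply: (@lt_le_trans _ _
      (limit_law gamma zeta a k.+2 * simplex_max_cdf k.+2 x)).
      by rewrite mulr_gt0 // law_gt0.
    apply: (@le_trans _ _ (series (fun k => limit_law gamma zeta a k * simplex_max_cdf k x) k.+3)).
      by rewrite /series /= big_nat_recr //= lerDr sumr_ge0.
    apply: nondecreasing_cvgn_le => //; apply: nondecreasing_series => i _ _.
    exact: term_ge0.
  apply: (cvg_asymp_equiv S0).
    have c0 : 0 < Num.ceil x^-1 by rewrite ceil_gt0 invr_gt0.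
    have := @coef_sum 1 S `|Num.ceil x^-1|%N (fun m => rho_m1 m x) (fun m => simplex_max_cdf m x).
    rewrite rmorph1 mulr1; apply => //.
    - by rewrite absz_gt0 gt_eqF.
    - by move=> m m0; rewrite mul1r rho_m1E.
    - move=> m /andP[m0 mc]; rewrite rho_m1E // simplex_max_cdf_eq0 ?(ltW x0) //.
      by rewrite -ltr_pdivlMr // mul1r; move: mc; rewrite -ltz_nat gtz0_abs // ceil_gt_int.
  apply: cvg_trans cP; apply: near_eq_cvg; near=> n.
  by rewrite (probability_gnedin (PiP n)).
pose c : R := j.+1%:R.
have c0 : c != 0 by rewrite pnatr_eq0.
pose h n k := if n is 0%N then 0 else moment_defect R n j k.
have hS n k : (0 < n)%N -> h n k = moment_defect R n j k by case: n.
have h01 n k : 0 <= h n k <= 1.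
  by case: n => [|n]; [rewrite /h lexx ler01|exact: moment_defect01].
have hE k : (0 < k)%N -> (fun n => h n k) @ \oo --> c * mu_m1 R j k.
  move=> k0; have cm := @cvg_moment_defect R j k k0; apply: cvg_trans cm; apply: near_eq_cvg.
  by exists 1%N => // -[].
(* A single block has size [n] and no defect; hence the series of moments starts at 2. *)
have h1 n : h n 1 = 0.
  case: n => // n; rewrite /h /moment_defect big1 ?mul0r // => i _.
  by rewrite /bounded_fraction compositions1 // leqNgt ltn_ord mul0r mulr0.
have mu1 : mu_m1 R j 1 = 0.
  apply: (mulfI c0); rewrite mulr0; apply: (cvg_unique _ (hE 1%N isT)) => //.
  by apply: cvg_near_cst; apply: nearW.
have [cS cE] := cvg_block_mixture g0 gz_gt0 ba h01 hE.
set S := limn _ in cE.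
(* The defect is at most 1 and vanishes on one block, whose limiting probability is positive; this
   keeps the limiting moment positive. *)
have S1 : S <= 1 - limit_law gamma zeta a 1.
  have cq : (fun n => 1 - block_law gamma zeta n 1) @ \oo --> 1 - limit_law gamma zeta a 1.
    by apply: cvgB; [exact: cvg_cst|exact: cvg_block_law].
  apply: (ler_cvg_to cE cq); near=> n.
  have n0 : (0 < n)%N by near: n; exists 1%N.
  have n1 : (1 < n.+1)%N by [].
  rewrite -(sum_block_law g0 gz_gt0 n0) (bigD1 (Ordinal n1)) //= h1 mulr0 add0r.
  rewrite [in leRHS](bigD1 (Ordinal n1)) //= addrAC subrr add0r.
  apply: ler_sum => k _; rewrite ler_piMr ?block_law_ge0 //.
  by case/andP: (h01 n k).
have S0 : 1 - S != 0.
  apply: lt0r_neq0; rewrite subr_gt0; apply: le_lt_trans S1 _.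
  by rewrite ltrBlDr ltrDl law_gt0.
apply: (cvg_asymp_equiv S0).
  rewrite rmorphB rmorph1; congr (1 - _).
  have -> : (j.+1%:R : R[i]) = c%:C by rewrite -natr_complex.
  have mu0 m : (0 < m < 2)%N -> mu_m1 R j m = 0.
    by move=> m2; have -> : m = 1%N by lia.
  exact: (coef_sum c S 2%N (mu_m1 R j) (fun k => c * mu_m1 R j k) c0 isT (fun _ _ => erefl) mu0 cS).
have nn : (fun n : nat => n%:R / n%:R) @ \oo --> (1 : R).
  apply: cvg_near_cst; near=> n; rewrite divff // pnatr_eq0 -lt0n.
  by near: n; exists 1%N.
have cf := @cvgn_ffact R id 1 j.+1 nn.
rewrite expr1n in cf.
apply: (@cvg_trans _ ((fun n => (n ^_ j.+1)%:R / n%:R ^+ j.+1 -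
    \sum_(k < n.+1) block_law gamma zeta n k * h n k) @ \oo)); last exact: cvgB cf cE.
apply: near_eq_cvg; near=> n.
have n0 : (0 < n)%N by near: n; exists 1%N.
rewrite (expectation_gnedin (PiP n)) /=; congr (_ - _).
by apply: eq_bigr => k _; rewrite hS.
Unshelve. all: by end_near. Qed.
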